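(* Let $G\in\mathcal{B}$ and let $r$ be an integer with $r\ge\max\{9,\Delta(G)\}$. Then $G$ is equitably $r$-choosable.
   Context: Graphs are finite and simple; $|G|$ is the number of vertices and $\Delta(G)$ the maximum degree of $G$. For disjoint $X,Y\subseteq V(G)$, $\|X,Y\|$ is the number of edges of $G$ connecting $X$ with $Y$. $\mathcal{B}$ is the class of graphs $G$ such that $\|X,Y\|\le 2|X\cup Y|-4$ for all disjoint $X,Y\subseteq V(G)$ with $|X\cup Y|\ge 3$. An $r$-list assignment $L$ for $G$ assigns to each vertex $v$ a set $L(v)$ of exactly $r$ colors. An $L$-coloring of $G$ is a proper coloring $f$ of $G$ with $f(v)\in L(v)$ for every vertex $v$. An $L$-coloring (for an $r$-list assignment $L$) is equitable if every color class has size at most $\lceil |G|/r\rceil$. A graph $G$ is equitably $r$-choosable if it has an equitable $L$-coloring for every $r$-list assignment $L$. *)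

(* Defs.v *)
From mathcomp Require Import all_boot.
From mathcomp Require Import finmap.

Set Implicit Arguments.
Unset Strict Implicit.
Unset Printing Implicit Defensive.

Record sgraph := SGraph {
  vertex :> finType;
  adj : rel vertex;
  adj_sym : symmetric adj;
  adj_irrefl : irreflexive adj
}.

Definition neighbors (G : sgraph) (v : G) : {set G} := [set w | adj v w].

Definition degree (G : sgraph) (v : G) : nat := #|neighbors v|.

Definition max_degree (G : sgraph) : nat := \max_(v : G) degree v.

(* Edges are counted as pairs (x, y) with x in X and y in Y, so each X-Y edge
   is counted exactly once provided that X and Y are disjoint. *)
Definition edges_between (G : sgraph) (X Y : {set G}) : nat :=
  #|[set p : G * G | [&& p.1 \in X, p.2 \in Y & adj p.1 p.2]]|.

(* The truncated subtraction is exact, since 2 * |X :|: Y| >= 6. *)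
Definition in_classB (G : sgraph) : Prop :=
  forall X Y : {set G}, [disjoint X & Y] -> 3 <= #|X :|: Y| ->
    edges_between X Y <= 2 * #|X :|: Y| - 4.

Definition list_assignment (G : sgraph) (C : choiceType) (r : nat)
    (L : G -> {fset C}) : Prop :=
  forall v, #|` L v| = r.

Definition proper_coloring (G : sgraph) (C : choiceType) (f : G -> C) : Prop :=
  forall v w, adj v w -> f v != f w.

Definition list_coloring (G : sgraph) (C : choiceType) (L : G -> {fset C})
    (f : G -> C) : Prop :=
  proper_coloring f /\ forall v, f v \in L v.

Definition color_class (G : sgraph) (C : choiceType) (f : G -> C) (c : C) :
    {set G} :=
  [set v | f v == c].

(* The ceiling of n / r, for r > 0. *)
Definition ceil_div (n r : nat) : nat := (n + r.-1) %/ r.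

Definition equitable (G : sgraph) (C : choiceType) (r : nat) (f : G -> C) :
    Prop :=
  forall c, #|color_class f c| <= ceil_div #|G| r.

Definition equitably_choosable (G : sgraph) (r : nat) : Prop :=
  forall (C : choiceType) (L : G -> {fset C}), list_assignment r L ->
    exists f : G -> C, list_coloring L f /\ equitable r f.

(* Main.v *)
Require Import Defs.
From mathcomp Require Import all_boot.
From mathcomp Require Import finmap zify.
From Stdlib Require Import Classical.

Set Implicit Arguments.
Unset Strict Implicit.
Unset Printing Implicit Defensive.

(* Vertices of degree at most 6 exist in every induced subgraph, so let [v] be
   one and colour the rest by induction, with classes of size at most [s] where
   [r s >= |G|].  Draw an arc from colour [c] to colour [d] when a vertex of
   colour [c] can be recoloured with [d].  If [v] cannot be added, consider the
   set [B] of the [b] colours from which no class with fewer than [s] vertices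
   can be reached.  Every vertex in the classes of [B] has a neighbour in each
   class of its list outside [B], so there are at least [b (r - b) s] edges
   leaving these classes; as [r >= 9], the condition on bipartite subgraphs
   leaves only [b <= 2] or [b >= r - 2], and the colours available for [v] show
   [b >= r - 2].  The same dichotomy holds for all sets of colours in [B] that
   are closed under reachability.

   Take [b] minimal, and let [x] be a vertex outside the classes of [B], of
   colour [a].  If [y] is a solo neighbour of [x] (its only neighbour coloured
   [a] is [x]), and [x] and [y] can be exchanged, possibly by way of a chain of
   recolourings in [B], then another solo neighbour [y'] of [x] not adjacent to
   [y] could be recoloured with [a], and [b] would decrease.  Hence [y] is
   adjacent to all other solo neighbours of [x], and as [G] has no [K_{3,3}]
   there is at most one such [y] if [x] has at least 5 solo neighbours.  So [x]
   has two neighbours or a non-solo one in nearly all classes of [B], which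
   bounds the number of vertices of [B] that the outer vertices can dominate,
   whereas they must dominate all of them [r - b] times. *)

(** * Cuts *)

Section Cuts.
Variable G : sgraph.
Implicit Types (X Y D : {set G}) (u v w x y : G).

Lemma in_nbr x y : (y \in neighbors x) = adj x y.
Proof. by rewrite inE. Qed.

Lemma card_setI_sum (T : finType) (A B : {set T}) :
  #|A :&: B| = \sum_(y in B) (y \in A).
Proof.
rewrite -sum1_card big_mkcond [RHS]big_mkcond; apply: eq_bigr => y _.
by rewrite inE; case: (y \in A); case: (y \in B).
Qed.

Lemma sum_nbr_swap X Y :
  \sum_(x in X) #|neighbors x :&: Y| = \sum_(y in Y) #|neighbors y :&: X|.
Proof.
under eq_bigr do rewrite card_setI_sum.
rewrite exchange_big; apply: eq_bigr => y _; rewrite card_setI_sum.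
by apply: eq_bigr => x _; rewrite !in_nbr adj_sym.
Qed.

Lemma edges_between_sum X Y :
  edges_between X Y = \sum_(x in X) #|neighbors x :&: Y|.
Proof.
under eq_bigr do rewrite card_setI_sum.
rewrite pair_big /= /edges_between -sum1_card big_mkcond [RHS]big_mkcond.
apply: eq_bigr => -[x y] _ /=; rewrite !inE /=.
by case: (x \in X); case: (y \in Y) => //=; case: (adj x y).
Qed.

Hypothesis hG : in_classB G.

Lemma classB_cut X Y : [disjoint X & Y] -> 3 <= #|X| + #|Y| ->
  \sum_(x in X) #|neighbors x :&: Y| + 4 <= 2 * (#|X| + #|Y|).
Proof.
move=> dXY h3; have := hG dXY; rewrite cardsU disjoint_setI0 // cards0 subn0.
by rewrite edges_between_sum => /(_ h3); lia.
Qed.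

Definition cut D X := \sum_(x in X) #|neighbors x :&: (D :\: X)|.

Lemma cutC D X : X \subset D -> cut D (D :\: X) = cut D X.
Proof.
move=> sXD; rewrite /cut sum_nbr_swap setDDr setDv set0U.
by rewrite (setIidPr sXD).
Qed.

Lemma cut_move D X v : X \subset D -> v \in X ->
  cut D (X :\ v) + #|neighbors v :&: (D :\: X)|
    = cut D X + #|neighbors v :&: X|.
Proof.
move=> sXD vX; have vD := subsetP sXD v vX.
have eD : D :\: (X :\ v) = v |: (D :\: X).
  by apply/setP=> z; rewrite !inE; case: eqP => // ->; rewrite vD.
rewrite /cut eD [X in _ = X + _](big_setD1 v vX) /=.
rewrite (eq_bigr (fun x => (v \in neighbors x) + #|neighbors x :&: (D :\: X)|));
  last first.
  by move=> x _; rewrite !card_setI_sum big_setU1 // !inE vX.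
rewrite big_split /= (card_setI_sum _ X) (big_setD1 v vX) /= in_nbr adj_irrefl.
rewrite (eq_bigr (fun x => (x \in neighbors v) : nat)); first by lia.
by move=> x _; rewrite !in_nbr adj_sym.
Qed.

(* In a cut of [G[D]] with the maximum number of edges at least half of the
   neighbours of each vertex lie across; if all degrees were at least 7 this
   would give at least [2 |D|] edges in the cut. *)
Lemma low_vertex D : D != set0 ->
  exists2 v, v \in D & #|neighbors v :&: D| <= 6.
Proof.
move=> /set0Pn[v0 v0D].
have [/exists_inP //|/exists_inPn hdeg] :=
  boolP [exists v in D, #|neighbors v :&: D| <= 6].
have [X sXD maxX] :=
  @arg_maxnP _ set0 (fun X => X \subset D) (cut D) (sub0set D).
have split Y v : Y \subset D ->
    #|neighbors v :&: D| = #|neighbors v :&: Y| + #|neighbors v :&: (D :\: Y)|.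
  move=> sYD; rewrite !card_setI_sum (big_setID Y) /=.
  by rewrite (setIidPr sYD).
(* Stated for every maximum cut, so that it applies to both sides of [X]. Half of at least 7
   neighbours means at least 4 across. *)
have half Y : Y \subset D -> cut D Y = cut D X -> 4 * #|Y| <= cut D X.
  move=> sYD cY; rewrite -cY mulnC -sum_nat_const; apply: leq_sum => v vY.
  have := hdeg v (subsetP sYD v vY); rewrite -ltnNge (split Y) //.
  have := cut_move sYD vY.
  have : cut D (Y :\ v) <= cut D X.
    by apply: maxX; apply: subset_trans sYD; apply: subsetDl.
  rewrite cY; lia.
have h1 := half X sXD erefl.
have h2 := half (D :\: X) (subsetDl _ _) (cutC sXD).
have cD : #|D| = #|X| + #|D :\: X| by rewrite -(cardsID X) (setIidPr sXD).
have D7 : 7 <= #|D|.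
  have := hdeg v0 v0D; rewrite -ltnNge => /leq_trans -> //.
  by rewrite subset_leq_card // subsetIr.
have dis : [disjoint X & D :\: X].
  by rewrite -setI_eq0; apply/eqP/setP=> z; rewrite !inE; case: (z \in X).
have := classB_cut dis; rewrite -/(cut D X) -cD => /(_ (leq_trans _ D7)).
by move=> /(_ isT); lia.
Qed.

(** The two sides span 3 |T| edges, but at most 2 (|T| + 3) - 4 are allowed, whence |T| <= 2. *)
Lemma classB_no_K33 (x y z : G) (T : {set G}) : uniq [:: x; y; z] ->
  3 <= #|T| ->
  (forall t, t \in T -> [&& adj x t, adj y t & adj z t]) -> False.
Proof.
move=> uxyz T3 hT; pose X := [set x; y; z].
have cX : #|X| = 3.
  by move: uxyz; rewrite /X -setUA !cardsU1 cards1 /= !inE; case: (_ || _) => //;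
     case: (_ == _).
have dis : [disjoint X & T].
  rewrite -setI_eq0; apply/eqP/setP=> t; rewrite !inE; apply/negP=> /andP[].
  by rewrite -orbA => /or3P[]/eqP-> /hT; rewrite adj_irrefl ?andbF.
have := classB_cut dis; rewrite cX => /(_ (leq_addr _ _)).
rewrite (eq_bigr (fun=> #|T|)) ?sum_nat_const ?cX; first by lia.
move=> t; rewrite !inE -orbA => tX; apply: eq_card => w; rewrite !inE.
case: (boolP (w \in T)) => [/hT/and3P[ax ay az]|]; last by rewrite andbF.
by case/or3P: tX => /eqP->; rewrite ?ax ?ay ?az.
Qed.

End Cuts.

(** * Partial colourings *)

Section PartialColorings.
Variables (G : sgraph) (K : finType) (L : G -> {set K}).
Implicit Types (f g h : G -> option K) (u v w x y : G) (a b c d : K).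
Implicit Types (X P : {set K}) (Z : {set G}).

Definition cls f c : {set G} := [set u | f u == Some c].

Definition colored_in f X : {set G} := [set u | oapp (mem X) false (f u)].

Definition upd f x o : G -> option K := fun z => if z == x then o else f z.

Definition pcol f :=
  (forall u w c, adj u w -> f u = Some c -> f w = Some c -> False) /\
  (forall u c, f u = Some c -> c \in L u).

Definition free f u c := (c \in L u) && [disjoint neighbors u & cls f c].

Definition movable f : rel K :=
  fun c d => [exists u, (f u == Some c) && free f u d].

Lemma in_cls f c u : (u \in cls f c) = (f u == Some c).
Proof. by rewrite inE. Qed.

Lemma in_colored f X u c : f u = Some c -> (u \in colored_in f X) = (c \in X).
Proof. by rewrite inE => ->. Qed.

Lemma colored_inP f X u :
  reflect (exists2 c, f u = Some c & c \in X) (u \in colored_in f X).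
Proof.
rewrite inE; case: (f u) => [c|] /=; last by constructor=> -[].
by apply: (iffP idP) => [cX|[_ [<-]] //]; exists c.
Qed.

Lemma freeP f u c :
  reflect (c \in L u /\ forall w, adj u w -> f w <> Some c) (free f u c).
Proof.
apply: (iffP andP) => -[cL h]; split=> //.
  by move=> w uw fw; have := disjointFr h (x := w); rewrite !inE uw fw eqxx => /(_ isT).
rewrite -setI_eq0; apply/eqP/setP=> w; rewrite !inE; apply/negP=> /andP[uw].
by move=> /eqP; apply: h.
Qed.

Lemma not_disjoint_cls f u c : ~~ [disjoint neighbors u & cls f c] ->
  exists2 w, adj u w & f w = Some c.
Proof.
rewrite -setI_eq0 => /set0Pn[w]; rewrite !inE => /andP[uw /eqP fw].
by exists w.
Qed.

Lemma updE f x o z : upd f x o z = if z == x then o else f z.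
Proof. by []. Qed.

Lemma upd_same f x o : upd f x o x = o.
Proof. by rewrite updE eqxx. Qed.

Lemma upd_neq f x o z : z != x -> upd f x o z = f z.
Proof. by rewrite updE => /negPf->. Qed.

Lemma pcol_erase f x : pcol f -> pcol (upd f x None).
Proof.
move=> [p l]; split=> [u w c uw|u c]; rewrite !updE.
  by do 2![case: eqP => // _]; apply: p.
by case: eqP => // _; apply: l.
Qed.

Lemma pcol_upd f x c : pcol f -> free f x c -> pcol (upd f x (Some c)).
Proof.
move=> [p l] /freeP[cL fr]; split=> [u w d uw|u d]; rewrite !updE.
  case: (u =P x) => [eu|_]; case: (w =P x) => [ew|_].
  - by move: uw; rewrite eu ew adj_irrefl.
  - by case=> <- fw; apply: fr fw; rewrite -eu.
  - by move=> fu [ec]; apply: (fr u); rewrite ?ec // adj_sym -ew.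
  - exact: p.
by case: eqP => [->|_ /l //] [<-].
Qed.

Lemma card_cls_upd f x o c :
  #|cls (upd f x o) c| + (f x == Some c) = #|cls f c| + (o == Some c).
Proof.
rewrite (cardsD1 x (cls f c)) (cardsD1 x (cls _ c)) !in_cls upd_same.
rewrite (_ : cls (upd f x o) c :\ x = cls f c :\ x); first by lia.
by apply/setP=> z; rewrite !inE updE; case: eqP.
Qed.

Lemma sum_colored_in f X (F : G -> nat) :
  \sum_(u in colored_in f X) F u = \sum_(c in X) \sum_(u in cls f c) F u.
Proof.
rewrite (exchange_big_dep (mem (colored_in f X))) /=; last first.
  by move=> c u cX; rewrite in_cls => /eqP fu; rewrite (in_colored _ fu).
apply: eq_bigr => u /colored_inP[c fu cX].
rewrite (big_pred1 c) // => d; rewrite in_cls fu /=.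
by case: (d =P c) => [->|ne]; rewrite ?eqxx ?andbT // andbC; case: eqP => // -[/esym].
Qed.

Lemma card_colored_in f X : #|colored_in f X| = \sum_(c in X) #|cls f c|.
Proof.
by rewrite -sum1_card sum_colored_in; apply: eq_bigr => c _; rewrite sum1_card.
Qed.

Lemma card_setI_colored_in Z f X :
  #|Z :&: colored_in f X| = \sum_(c in X) #|Z :&: cls f c|.
Proof.
rewrite card_setI_sum sum_colored_in; apply: eq_bigr => c _.
by rewrite card_setI_sum.
Qed.

Lemma card_le_colored_in Z f P :
  (forall c, c \in P -> ~~ [disjoint Z & cls f c]) ->
  #|P| <= #|Z :&: colored_in f P|.
Proof.
move=> h; rewrite card_setI_colored_in -sum1_card; apply: leq_sum => c cP.
by rewrite card_gt0 setI_eq0 h.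
Qed.

Lemma colored_inU f X P : colored_in f (X :|: P) = colored_in f X :|: colored_in f P.
Proof. by apply/setP=> u; rewrite !inE; case: (f u) => //= c; rewrite inE. Qed.

Lemma colored_inS f X P : X \subset P -> colored_in f X \subset colored_in f P.
Proof.
move=> /subsetP s; apply/subsetP=> u; rewrite !inE.
by case: (f u) => //= c; apply: s.
Qed.

Lemma colored_in_disjoint f X P : [disjoint X & P] ->
  [disjoint colored_in f X & colored_in f P].
Proof.
move=> d; rewrite -setI_eq0; apply/eqP/setP=> u; rewrite !inE.
case: (f u) => //= c; apply/negP=> /andP[cX cP].
by rewrite (disjointFr d cX) in cP.
Qed.

(* The vertex [x] takes the first colour of the path; each colour of the path
   passes one of its vertices on to the next colour. *)
Lemma shift f x b p : pcol f -> f x = None -> free f x b ->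
  path (movable f) b p -> uniq (b :: p) ->
  exists h, [/\ pcol h, forall u, (h u == None) = (u != x) && (f u == None),
    forall c, #|cls h c| = #|cls f c| + (c == last b p)
    & forall u c, c \notin b :: p -> (h u == Some c) = (f u == Some c)].
Proof.
elim: p f x b => [|c p IH] f x b pf fx fr /=.
  move=> _ _; exists (upd f x (Some b)); split.
  - exact: pcol_upd.
  - by move=> u; rewrite updE; case: (u =P x).
  - move=> c; have := card_cls_upd f x (Some b) c.
    by rewrite fx (eq_sym c) addn0 => ->.
  - move=> u c; rewrite mem_seq1 updE; case: (u =P x) => // -> ne.
    by rewrite fx; apply/eqP=> -[e]; rewrite e eqxx in ne.
case/andP=> /existsP[u0 /andP[/eqP fu0 fr0]] pth.
rewrite -/(uniq (c :: p)) => /andP[bp up].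
have u0x : u0 != x by apply/eqP=> e; rewrite e fx in fu0.
(* Now [u0] is the uncoloured vertex to be placed. [f1] and [f] agree on all colours but [b], which
   does not recur on the simple path, so the remaining arcs survive. *)
pose f1 := upd (upd f x (Some b)) u0 None.
have f1E d w : d != b -> (f1 w == Some d) = (f w == Some d).
  move=> db; rewrite /f1 !updE; case: (w =P u0) => [->|_].
    by rewrite fu0 /=; apply/esym/eqP=> -[e]; rewrite e eqxx in db.
  case: (w =P x) => // ->; rewrite fx.
  by apply/eqP=> -[e]; rewrite e eqxx in db.
have free1 d w : d != b -> free f w d -> free f1 w d.
  move=> db /freeP[dL h]; apply/freeP; split=> // z /h {h} + /eqP.
  by rewrite f1E // => h /eqP.
have nb d : d \in c :: p -> d != b by apply: contraTneq => ->.
have [||||h [ph domh szh outh]] := IH f1 u0 c _ _ _ _ up.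
- exact/pcol_erase/pcol_upd.
- exact: upd_same.
- by apply: free1 => //; apply: nb; rewrite mem_head.
- apply: (sub_in_path (P := mem (c :: p))) (pth); last by apply/allP.
  move=> d e /nb db /nb eb /existsP[w /andP[fw frw]].
  by apply/existsP; exists w; rewrite f1E // fw free1.
exists h; split=> //.
- move=> u; rewrite domh /f1 !updE; case: (u =P u0) => [->|_].
    by rewrite fu0 andbF.
  by case: (u =P x).
- move=> d; rewrite szh; congr (_ + _).
  have := card_cls_upd f x (Some b) d.
  have := card_cls_upd (upd f x (Some b)) u0 None d.
  rewrite fx upd_neq // fu0 -/f1 /=; lia.
- move=> u d; rewrite inE negb_or => /andP[db dp].
  by rewrite outh // f1E.
Qed.

(** No arc of a simple path leaves its last vertex. [cascade] needs this because the class of the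
    last colour may have lost the vertex that an arc would move. *)
Lemma path_avoid_last (T : eqType) (e : rel T) (i : T) p :
  path e i p -> uniq (i :: p) ->
  path (fun j k => e j k && (j != last i p)) i p.
Proof.
elim: p i => //= j p IH i /andP[-> pth] /andP[ip up] /=.
rewrite IH // andbT; apply: contraNneq ip => ->; exact: mem_last.
Qed.

(* Variant of [shift] in which [g] is a modification of [f]: it may differ from
   [f] outside the colours of [X], and may have lost vertices in the last
   class [c]. *)
Lemma cascade f g X x b c :
  (forall d e, d \in X -> movable f d e -> e \in X) -> b \in X ->
  connect (movable f) b c ->
  (forall u d, f u = Some d -> d \in X -> d <> c -> g u = Some d) ->
  (forall u d, g u = Some d -> d \in X -> f u = Some d) ->
  pcol g -> g x = None -> free g x b ->
  exists h, [/\ pcol h, forall u, (h u == None) = (u != x) && (g u == None),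
    forall d, #|cls h d| = #|cls g d| + (d == c)
    & forall u d, d \notin X -> (h u == Some d) = (g u == Some d)].
Proof.
move=> clX bX /connectP[p0 pth0 ->] keep shrink pg gx fr.
case/shortenP: pth0 keep => p pth up _ keep.
have pX : all (mem X) (b :: p).
  elim: p b bX pth {up keep fr} => [|d p IH] b bX /=; first by rewrite bX.
  by case/andP=> bd pth; rewrite bX; apply: IH pth; apply: clX bX bd.
have [|h [ph domh szh outh]] := shift pg gx fr _ up.
  (* An arc of [f] survives in [g]: the vertex to be moved has kept its colour, since [d] is not the
     last one, and the class of [e] has gained nothing. *)
  have := path_avoid_last pth up; apply: (sub_in_path (P := mem X)) => // d e.
  move=> dX eX /andP[/existsP[w /andP[/eqP fw /freeP[eL frw]]] /eqP dl].
  apply/existsP; exists w; rewrite (keep _ _ fw dX dl) eqxx /=.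
  by apply/freeP; split=> // z wz /shrink/(_ eX); apply: frw.
exists h; split=> // u d dX; apply: outh; apply: contra dX.
exact: (allP pX).
Qed.

End PartialColorings.

(** * Colourings that cannot be extended *)

Lemma card_setI_disjointU (T : finType) (Z A B : {set T}) : [disjoint A & B] ->
  #|Z :&: (A :|: B)| = #|Z :&: A| + #|Z :&: B|.
Proof.
rewrite -setI_eq0 => /eqP dis.
by rewrite setIUr cardsU setIACA setIid dis setI0 cards0 subn0.
Qed.

Section Stuck.
Variables (G : sgraph) (K : finType) (L : G -> {set K}) (r s : nat).
Variables (D : {set G}) (v : G).
Implicit Types (f g h : G -> option K) (u w x y : G) (a b c d : K).
Implicit Types (X P Q : {set K}) (Z : {set G}).

Hypothesis hG : in_classB G.
Hypothesis hr : 9 <= r.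
Hypothesis hdeg : forall x, #|neighbors x| <= r.
Hypothesis hL : forall x, #|L x| = r.
Hypothesis hv : v \in D.
Hypothesis hv6 : #|neighbors v :&: D| <= 6.
Hypothesis hD : #|D| <= r * s.

Definition state f := [/\ pcol L f, forall c, #|cls f c| <= s
  & forall u, (f u == None) = (u \notin D) || (u == v)].

Hypothesis no_coloring : forall f, pcol L f -> (forall c, #|cls f c| <= s) ->
  (forall u, (f u == None) = (u \notin D)) -> False.

(** * Accessible colours and closed sets of colours *)

Definition closed f X := forall c d, c \in X -> movable L f c d -> d \in X.

Definition reach f b := [set c | connect (movable L f) b c].

Definition acc f :=
  [set c | [exists d, connect (movable L f) c d && (#|cls f d| < s)]].

(** This is the set B of the introductory comment, and b is its size. *)
Notation blk f := (~: acc f).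

Lemma s_gt0 : 0 < s.
Proof.
have : 0 < #|D| by apply/card_gt0P; exists v.
by move/leq_trans/(_ hD); rewrite muln_gt0 => /andP[].
Qed.

Lemma accP f c : reflect
  (exists2 d, connect (movable L f) c d & #|cls f d| < s) (c \in acc f).
Proof.
rewrite inE; apply: (iffP existsP) => [[d /andP[]]|[d cd dS]]; exists d => //.
by rewrite cd.
Qed.

Lemma acc_nonfull f c : #|cls f c| < s -> c \in acc f.
Proof. by move=> h; apply/accP; exists c. Qed.

Lemma acc_movable f c d : movable L f c d -> d \in acc f -> c \in acc f.
Proof.
move=> cd /accP[e de eS]; apply/accP; exists e => //.
exact: connect_trans (connect1 cd) de.
Qed.

Lemma blk_full f c : state f -> c \in blk f -> #|cls f c| = s.
Proof.
case=> _ sz _; rewrite inE => /negP nc; apply/eqP; rewrite eqn_leq sz leqNgt.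
by apply/negP=> /acc_nonfull.
Qed.

Lemma closed_blk f : closed f (blk f).
Proof.
by move=> c d; rewrite !inE => nc cd; apply: contra nc; rewrite -!in_set;
   have := acc_movable cd; rewrite !inE.
Qed.

Lemma closed_reach f b : closed f (reach f b).
Proof.
move=> c d; rewrite !inE => bc cd; exact: connect_trans bc (connect1 cd).
Qed.

Lemma closedI f X P : closed f X -> closed f P -> closed f (X :&: P).
Proof.
move=> cX cP c d; rewrite !inE => /andP[hX hP] cd.
by rewrite (cX _ _ hX cd) (cP _ _ hP cd).
Qed.

Lemma closedU f X P : closed f X -> closed f P -> closed f (X :|: P).
Proof.
move=> cX cP c d; rewrite !inE => /orP[h|h] cd.
  by rewrite (cX _ _ h cd).
by rewrite (cP _ _ h cd) orbT.
Qed.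

Lemma reach_refl f b : b \in reach f b.
Proof. by rewrite inE. Qed.

Lemma reach_sub f X b : closed f X -> b \in X -> reach f b \subset X.
Proof.
move=> cX bX; apply/subsetP=> c; rewrite inE => /connectP[p].
elim: p b bX => [|d p IH] b bX /= => [_ -> //|/andP[bd pth]].
by apply: IH pth; apply: cX bX bd.
Qed.

Lemma closed_nbr f X u c d : closed f X -> f u = Some c -> c \in X ->
  d \in L u -> d \notin X -> ~~ [disjoint neighbors u & cls f d].
Proof.
move=> cX fu cXm dL; apply: contra => dis; apply: cX cXm _.
by apply/existsP; exists u; rewrite fu eqxx /free dL.
Qed.

Lemma closed_card_nbr f X P u : closed f X -> [disjoint X & P] ->
  u \in colored_in f X -> #|L u :&: P| <= #|neighbors u :&: colored_in f P|.
Proof.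
move=> cX dis /colored_inP[c fu cXm].
apply: leq_trans (_ : #|neighbors u :&: colored_in f (L u :&: P)| <= _); last first.
  by apply/subset_leq_card/setIS/colored_inS/subsetIr.
apply: card_le_colored_in => d; rewrite inE => /andP[dL dP].
apply: closed_nbr fu cXm dL _ => //; apply/negP=> dX.
by rewrite (disjointFr dis dX) in dP.
Qed.

Lemma card_colored_blk f X : state f -> X \subset blk f ->
  #|colored_in f X| = #|X| * s.
Proof.
move=> st /subsetP sX; rewrite card_colored_in -sum_nat_const.
by apply: eq_bigr => c /sX; apply: blk_full.
Qed.

(** Strict because [v] belongs to [D] and is uncoloured. *)
Lemma card_colored_lt f X P : state f -> [disjoint X & P] ->
  #|colored_in f X| + #|colored_in f P| < r * s.
Proof.
move=> [_ _ dom] dis; apply: leq_trans hD; rewrite (cardsD1 v D) hv ltnS.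
have := colored_in_disjoint f dis; rewrite -setI_eq0 => /eqP di.
rewrite -[leqLHS]subn0 -(cards0 G) -di -cardsU -colored_inU.
apply/subset_leq_card/subsetP=> u /colored_inP[c fu _].
have := dom u; rewrite fu => /esym/negbT.
by rewrite negb_or negbK !inE andbC.
Qed.

(** Each of the |X| s vertices in the full classes of [X] has a neighbour in every class of its list
    outside [X], hence at least r - |X| neighbours there. The right side comes from the cut bound on
    fewer than r s coloured vertices. *)
Lemma closed_cut f X : state f -> closed f X -> X \subset blk f ->
  3 <= #|X| -> #|X| * s * (r - #|X|) + 4 < 2 * (r * s).
Proof.
move=> st cX sX X3.
have dis : [disjoint X & ~: X] by rewrite disjoints_subset setCK.
have cXs := card_colored_blk st sX; have s0 := s_gt0.
have := classB_cut hG (colored_in_disjoint f dis).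
have := card_colored_lt st dis.
rewrite cXs => lt /(_ (leq_trans _ (leq_addr _ _))) => /(_ _) h.
have {}h : \sum_(x in colored_in f X) #|neighbors x :&: colored_in f (~: X)| + 4
           <= 2 * (#|X| * s + #|colored_in f (~: X)|).
  by apply: h; nia.
apply: leq_ltn_trans (_ : _ <= 2 * (#|X| * s + #|colored_in f (~: X)|)) _.
  apply: leq_trans h; rewrite leq_add2r -cXs -sum_nat_const.
  apply: leq_sum => u uX; apply: leq_trans (closed_card_nbr cX dis uX).
  by rewrite -setDE cardsD hL leq_sub2l // subset_leq_card // subsetIr.
by lia.
Qed.

Lemma closed_lt f X : state f -> X \subset blk f -> #|X| < r.
Proof.
move=> st sX; have dis : [disjoint X & set0] by rewrite -setI_eq0 setI0.
have := card_colored_lt st dis; rewrite (card_colored_blk st sX).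
have := s_gt0; nia.
Qed.

Lemma closed_size f X : state f -> closed f X -> X \subset blk f ->
  (#|X| <= 2) || (r - 2 <= #|X|).
Proof.
move=> st cX sX; have lt := closed_lt st sX; rewrite leqNgt -implybE.
apply/implyP=> X3; rewrite leqNgt; apply/negP=> Xr.
have := closed_cut st cX sX X3; have := s_gt0.
set k := #|X| in lt X3 Xr *; set m := r - k.
have er : r = k + m by rewrite /m; lia.
(* Equivalent to (k - 2) (m - 2) >= 4. Both factors are positive and their sum is at least 5, as r
   >= 9. *)
have : 2 * r <= k * m.
  rewrite er; have : 4 <= (k - 2) * (m - 2); last by nia.
  by have := hr; rewrite er; nia.
nia.
Qed.

(** Otherwise [v] takes [c], and shifting vertices along a path to a class with fewer than [s]
    vertices colours all of [D]. *)
Lemma free_blk f c : state f -> free L f v c -> c \in blk f.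
Proof.
move=> [pf sz dom] fr; rewrite inE; apply/negP=> /accP[d cd dS].
have fv : f v = None by apply/eqP; rewrite dom eqxx orbT.
have [||||h [ph domh szh _]] :=
  cascade (f := f) (g := f) (X := setT) (x := v) _ _ cd _ _ pf fv fr => //.
apply: (no_coloring ph) => [e|u].
  by rewrite szh; case: eqP => [->|_]; rewrite ?addn1 ?addn0.
by rewrite domh dom; case: (u =P v) => [->|_] /=; rewrite ?hv ?orbF.
Qed.

(** * Colours available for the uncoloured vertex *)

Definition start f := [set c | free L f v c].

(** The neighbours of [v] in [D] block at most 6 of at least 9 colours. Three colours suffice to
    exclude the lower alternative of [closed_size]. *)
Lemma start_card f : state f -> 3 <= #|start f|.
Proof.
move=> [pf sz dom].
have sub : L v :\: start f \subset L v by apply: subsetDl.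
have : #|L v :\: start f| <= 6.
  apply: leq_trans hv6.
  apply: leq_trans (_ : #|neighbors v :&: colored_in f (L v :\: start f)| <= _).
    apply: card_le_colored_in => c; rewrite !inE /free => /andP[+ cL].
    by rewrite cL.
  apply/subset_leq_card/setIS/subsetP=> u /colored_inP[c fu _].
  by have := dom u; rewrite fu => /esym/negbT; rewrite negb_or negbK => /andP[].
rewrite cardsD hL; have : #|L v :&: start f| <= #|start f|.
  by rewrite subset_leq_card // subsetIr.
move: hr; lia.
Qed.

Definition reach_start f := [set c | [exists b in start f, c \in reach f b]].

Lemma closed_reach_start f : closed f (reach_start f).
Proof.
move=> c d; rewrite !inE => /exists_inP[b bS cb] cd.
by apply/exists_inP; exists b => //; apply: closed_reach cb cd.
Qed.

Lemma reach_start_sub f : state f -> reach_start f \subset blk f.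
Proof.
move=> st; apply/subsetP=> c; rewrite inE => /exists_inP[b bS cb].
apply: subsetP cb; apply: reach_sub; first exact: closed_blk.
by apply: free_blk => //; rewrite inE in bS.
Qed.

Lemma reach_start_card f : state f -> r - 2 <= #|reach_start f|.
Proof.
move=> st.
have /orP[h|//] := closed_size st (@closed_reach_start f) (reach_start_sub st).
have : #|start f| <= #|reach_start f|.
  apply/subset_leq_card/subsetP=> c cS; rewrite inE; apply/exists_inP.
  by exists c => //; apply: reach_refl.
by have := start_card st; lia.
Qed.

(** The upper bound holds since [r] full classes would need r s coloured vertices. The two possible
    values are the two cases treated below. *)
Lemma blk_card f : state f -> r - 2 <= #|blk f| <= r - 1.
Proof.
move=> st; apply/andP; split.
  apply: leq_trans (reach_start_card st) _.
  exact/subset_leq_card/reach_start_sub.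
by have := closed_lt st (subxx (blk f)); lia.
Qed.

Lemma reach_startE f : state f -> #|blk f| = r - 2 -> reach_start f = blk f.
Proof.
move=> st e; apply/eqP; rewrite eqEcard reach_start_sub // e.
exact: reach_start_card.
Qed.

(** By [closed_size], every other colour of [blk f] reaches all of [blk f] but at most one
    colour. *)
Definition small f := [set c in blk f | #|reach f c| <= 2].

Lemma closed_small f : closed f (small f).
Proof.
move=> c d; rewrite inE => /andP[cB c2] cd.
rewrite inE (closed_blk cB cd) /=; apply: leq_trans c2.
apply/subset_leq_card/reach_sub; first exact: closed_reach.
by rewrite inE connect1.
Qed.

Lemma small_sub f : small f \subset blk f.
Proof. by apply/subsetP=> c; rewrite inE => /andP[]. Qed.

(** The colours reached from three small ones would form a closed set of size between 3 and 6, and 6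
    < r - 2. *)
Lemma small_card f : state f -> #|small f| <= 2.
Proof.
move=> st; rewrite leqNgt; apply/negP=> /card_gt2P[b1 [b2 [b3 [[h1 h2 h3] [n1 n2 n3]]]]].
pose X := reach f b1 :|: reach f b2 :|: reach f b3.
have cX : closed f X by do 2?[apply: closedU]; apply: closed_reach.
have sub b : b \in small f -> reach f b \subset blk f.
  by move=> bQ; apply: reach_sub (@closed_blk f) (subsetP (small_sub f) _ bQ).
have sX : X \subset blk f by rewrite !subUset !sub.
have c2 b : b \in small f -> #|reach f b| <= 2 by rewrite inE => /andP[].
have X6 : #|X| <= 6.
  have := c2 _ h1; have := c2 _ h2; have := c2 _ h3.
  by rewrite /X !cardsU; clear; lia.
have X3 : 3 <= #|X|.
  apply/card_gt2P; exists b1, b2, b3; split; split => //.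
  - by rewrite !in_setU reach_refl.
  - by rewrite !in_setU reach_refl orbT.
  - by rewrite !in_setU reach_refl orbT.
by have /orP[] := closed_size st cX sX; move: X3 X6 hr; clear; lia.
Qed.

Lemma small_reach f c : state f -> c \in blk f -> c \notin small f ->
  r - 2 <= #|reach f c|.
Proof.
move=> st cB; rewrite inE cB /= => nc.
have := closed_size st (@closed_reach f c) (reach_sub (@closed_blk f) cB).
by rewrite (negPf nc).
Qed.

(* Counts the edges between the classes of [X] minus [Q] and all other classes,
   those of [Q] included. *)
Lemma two_closed f X Q : state f -> closed f X -> X \subset blk f ->
  #|X| = r - 2 -> closed f Q -> Q \subset X -> #|Q| = 2 ->
  2 * (r * s) + 6 <= \sum_(y in colored_in f Q) #|L y :\: X| + 12 * s.
Proof.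
move=> st cX sX X2 cQ sQ Q2; have s0 := s_gt0.
pose Y := X :\: Q.
have cY : #|Y| = r - 4 by rewrite cardsD (setIidPr sQ) X2 Q2; lia.
have sY : Y \subset blk f by apply: subset_trans sX; apply: subsetDl.
have disXC : [disjoint X & ~: X] by rewrite disjoints_subset setCK.
have disQC : [disjoint ~: X & Q].
  by rewrite disjoint_sym; apply: disjointWl disXC.
have disQY : [disjoint Q & Y].
  by rewrite -setI_eq0; apply/eqP/setP=> c; rewrite !inE; case: (c \in Q).
have dis : [disjoint ~: X :|: Q & Y].
  rewrite -setI_eq0 setIUl setU_eq0 !setI_eq0 disQY andbT disjoint_sym.
  by apply: disjointWl disXC; apply: subsetDl.
have colY := card_colored_blk st sY.
have lt := card_colored_lt st dis.
have Y3 : 3 <= (r - 4) * s by move: hr; nia.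
have := classB_cut hG (colored_in_disjoint f dis).
rewrite colY cY in lt *; move=> /(_ (leq_trans Y3 (leq_addl _ _))).
rewrite sum_nbr_swap colored_inU.
under eq_bigr => y _ do rewrite (card_setI_disjointU _ (colored_in_disjoint f disQC)).
rewrite big_split /= -(sum_nbr_swap (colored_in f Q)) => le.
have e1 : (r - 4) * s * 2
    <= \sum_(y in colored_in f Y) #|neighbors y :&: colored_in f (~: X)|.
  rewrite -cY -colY -sum_nat_const; apply: leq_sum => y yY.
  have yX : y \in colored_in f X.
    by apply: subsetP yY; apply/colored_inS/subsetDl.
  apply: leq_trans (closed_card_nbr cX disXC yX).
  rewrite -setDE cardsD hL; have : #|L y :&: X| <= #|X|.
    by rewrite subset_leq_card // subsetIr.
  by rewrite X2; move: hr; clear; lia.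
(* A list has at least r - 2 colours outside [Q]. Those in [Y] force a neighbour, as [Q] is closed;
   the rest lie outside [X] and are counted by the first sum. *)
have e2 : 2 * s * (r - 2) <= \sum_(y in colored_in f Q) #|L y :\: X|
    + \sum_(y in colored_in f Q) #|neighbors y :&: colored_in f Y|.
  rewrite -Q2 -(card_colored_blk st (subset_trans sQ sX)) -sum_nat_const.
  rewrite -big_split; apply: leq_sum => y yQ /=.
  have := closed_card_nbr cQ disQY yQ.
  have : #|L y| = #|L y :\: X| + #|L y :&: Y| + #|L y :&: Q|.
    have eY : L y :&: Y = (L y :&: X) :\: Q.
      by apply/setP=> c; rewrite !inE; case: (c \in Q); rewrite ?andbF ?andbT.
    have eQ : L y :&: Q = (L y :&: X) :&: Q.
      by rewrite -setIA (setIidPr sQ).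
    by rewrite -(cardsID X (L y)) -(cardsID Q (L y :&: X)) -eY -eQ; clear; lia.
  have : #|L y :&: Q| <= #|Q| by rewrite subset_leq_card // subsetIr.
  by rewrite hL Q2; move: hr; clear; lia.
have rs : 9 * s <= r * s by rewrite leq_mul2r hr orbT.
move: rs le e1 e2 lt; rewrite (_ : 2 * s * (r - 2) = 2 * (r * s - 2 * s)); last first.
  by rewrite -mulnBl; clear; lia.
by rewrite mulnBl -colored_inU; clear; lia.
Qed.

Lemma colored_neq f x y c d : f x = Some c -> f y = Some d -> c != d -> x != y.
Proof. by move=> fx fy; apply: contraNneq => e; move: fx; rewrite e fy => -[->]. Qed.

Lemma acc_blk_neq f c d : c \in acc f -> d \in blk f -> c != d.
Proof. by move=> cA; rewrite inE; apply: contraNneq => <-. Qed.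

(** * Exchanges of a vertex with a solo neighbour, and the resulting weights *)

Section Exchange.
Variables (f : G -> option K) (ex : K -> {set G}).
Hypothesis st : state f.
Hypothesis hmin : forall g, state g -> #|blk f| <= #|blk g|.

(* [ex a] collects the neighbours of a vertex that must remain free to move to
   colour [a]; such vertices may not take this colour. *)
Definition solo x := [set y in neighbors x | (y \in colored_in f (blk f)) &&
  oapp (fun a => [&& a \in L y, neighbors y :&: cls f a \subset [set x]
                   & y \notin ex a]) false (f x)].

(** An exchange must not make an accessible colour inaccessible. The reason for this differs in the
    two cases on the size of [blk f]. *)
Hypothesis acc_stable : forall g x y a, state g -> f x = Some a ->
  a \in acc f -> y \in solo x -> (forall c, #|cls g c| = #|cls f c|) ->
  (forall w c, c \in acc f ->
     (g w == Some c) = (upd (upd f x None) y (Some a) w == Some c)) ->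
  acc f \subset acc g.

Lemma soloP x y a : f x = Some a ->
  reflect [/\ adj x y, y \in colored_in f (blk f), a \in L y,
             forall w, adj y w -> f w = Some a -> w = x & y \notin ex a]
    (y \in solo x).
Proof.
move=> fx; rewrite [_ \in solo x]inE fx in_nbr /=; apply: (iffP and3P).
  case=> xy yB /and3P[aL /subsetP h yE]; split=> // w yw fw.
  by apply/set1P/h; rewrite !inE yw fw eqxx.
case=> xy yB aL h yE; split=> //; apply/and3P; split=> //.
by apply/subsetP=> w; rewrite !inE => /andP[yw /eqP fw]; apply/eqP/h.
Qed.

Lemma solo_sub x : solo x \subset neighbors x.
Proof. by apply/subsetP=> y; rewrite inE => /andP[]. Qed.

Lemma solo_sub_blk x : solo x \subset colored_in f (blk f).
Proof. by apply/subsetP=> y; rewrite inE => /and3P[]. Qed.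

Lemma blk_minimal g c : state g -> acc f \subset acc g -> c \in blk f ->
  c \in acc g -> False.
Proof.
move=> sg sub cB cA; have := hmin sg; rewrite leqNgt => /negP; apply.
apply: proper_card; apply/properP; split; first by rewrite setCS.
by exists c => //; rewrite in_setC negbK.
Qed.

(** Let [y] take the colour [a] and [x] the colour [b]; a cascade from [b] refills the place that
    [y] left, so all class sizes persist. If [y'] were not adjacent to [y], it would no longer see
    the colour [a], and its colour would become accessible, against the minimality of [blk f]. *)
Lemma exchange x y y' a b : f x = Some a -> a \in acc f ->
  y \in solo x -> y' \in solo x -> y' != y -> b \in L x -> b \in blk f ->
  (forall w, adj x w -> f w = Some b -> w = y) ->
  (forall c, f y = Some c -> connect (movable L f) b c) -> adj y y'.
Proof.
move=> fx aA yS yS' ne bL bB only conn; apply/negPn/negP=> nadj.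
have [pf sz dom] := st.
have [xy /colored_inP[c fy cB] aLy yonly yE] := soloP y fx yS.
have [xy' /colored_inP[c' fy' cB'] aLy' yonly' yE'] := soloP y' fx yS'.
have ac := acc_blk_neq aA cB; have ac' := acc_blk_neq aA cB'.
have nyx : y != x by rewrite eq_sym; apply: colored_neq fx fy ac.
have nyx' : y' != x by rewrite eq_sym; apply: colored_neq fx fy' ac'.
pose f1 := upd (upd f x None) y (Some a).
have f1E w d : d \in blk f -> f1 w = Some d -> f w = Some d /\ w != y.
  move=> dB; rewrite /f1 !updE; case: (w =P y) => [_ [e]|_].
    by have := acc_blk_neq aA dB; rewrite e eqxx.
  by case: (w =P x).
have [] := @cascade _ _ L f f1 (blk f) x b c (@closed_blk f) bB (conn _ fy).
- move=> u d fu dB /eqP dc; rewrite /f1 !upd_neq //.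
    by rewrite eq_sym; apply: colored_neq fx fu (acc_blk_neq aA dB).
  exact: colored_neq fu fy dc.
- by move=> u d /f1E h /h[].
- apply: pcol_upd; first exact: pcol_erase.
  apply/freeP; split=> // w yw; rewrite updE; case: (w =P x) => // wx fw.
  by apply: wx; apply: yonly.
- by rewrite /f1 upd_neq 1?eq_sym // upd_same.
- apply/freeP; split=> // w xw /(f1E _ _ bB)[fw]; rewrite (only w xw fw).
  by rewrite eqxx.
move=> g [pg domg szg outg].
have szE d : #|cls g d| = #|cls f d|.
  have := card_cls_upd (upd f x None) y (Some a) d.
  have := card_cls_upd f x None d.
  rewrite (upd_neq _ _ nyx) fx fy szg -/f1 (eq_sym d) /=.
  by rewrite -[Some c == Some d]/(c == d); clear; lia.
have sg : state g.
  split=> // [d|u]; first by rewrite szE.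
  rewrite domg /f1 !updE -dom; case: (u =P y) => [->|_]; first by rewrite fy andbF.
  by case: (u =P x) => [->|_] //; rewrite fx.
have sub : acc f \subset acc g.
  apply: (acc_stable sg fx aA yS szE) => w d dA; apply: outg.
  by rewrite in_setC negbK.
(* The cascade may have recoloured [y'], but only with another colour of [blk f]. *)
have [d gy' dB] : exists2 d, g y' = Some d & d \in blk f.
  case gy' : (g y') => [d|].
    exists d => //; apply/negPn/negP=> dB; have := outg y' d dB.
    rewrite gy' eqxx /f1 !upd_neq // fy' => /esym/eqP[e].
    by rewrite -e cB' in dB.
  by move: gy' => /eqP; rewrite domg /f1 !upd_neq // fy' andbF.
apply: (blk_minimal sg sub dB); apply: acc_movable (subsetP sub _ aA).
apply/existsP; exists y'; rewrite gy' eqxx /=; apply/freeP; split=> // w yw /eqP.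
rewrite (outg w a) ?in_setC ?aA // /f1 !updE; case: (w =P y) => [ew _|_].
  by move: nadj; rewrite -ew adj_sym yw.
by case: (w =P x) => // wx /eqP fw; apply: wx; apply: yonly'.
Qed.

Definition dominating x :=
  [set y in solo x | [forall y' in solo x, (y' != y) ==> adj y y']].

(** Two dominating vertices and [x] would have the other solo neighbours, at least 3, in common. *)
Lemma dominating_le1 x : 5 <= #|solo x| -> #|dominating x| <= 1.
Proof.
move=> S5; rewrite leqNgt; apply/negP=> /card_gt1P[y1 [y2 [y1D y2D ne]]].
have dom y : y \in dominating x -> y \in solo x /\
    forall y', y' \in solo x -> y' != y -> adj y y'.
  rewrite inE => /andP[yS /forall_inP h]; split=> // y' yS' ne'.
  by have /implyP := h y' yS'; apply.
have [y1S a1] := dom _ y1D; have [y2S a2] := dom _ y2D.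
pose T := solo x :\ y1 :\ y2.
have xN y : y \in solo x -> adj x y by move/(subsetP (solo_sub x)); rewrite inE.
apply: (@classB_no_K33 G hG x y1 y2 T).
- rewrite /= !inE ne !andbT negb_or; apply/andP; split; apply/eqP=> e.
    by have := xN _ y1S; rewrite -e adj_irrefl.
  by have := xN _ y2S; rewrite -e adj_irrefl.
- have := cardsD1 y1 (solo x); have := cardsD1 y2 (solo x :\ y1).
  by move: S5; rewrite -/T; do 2![case: (_ \in _)] => /=; clear; lia.
- move=> t; rewrite !in_setD1 => /and3P[t2 t1 tS].
  by rewrite xN // a1 // a2.
Qed.

Lemma exchange_dominating x y a b : f x = Some a -> a \in acc f ->
  y \in solo x -> b \in L x -> b \in blk f ->
  (forall w, adj x w -> f w = Some b -> w = y) ->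
  (forall c, f y = Some c -> connect (movable L f) b c) -> y \in dominating x.
Proof.
move=> fx aA yS bL bB only conn; rewrite inE yS; apply/forall_inP=> y' yS'.
by apply/implyP=> ne; apply: exchange fx aA yS yS' ne bL bB only conn.
Qed.

Definition zeros x X := [set b in L x :&: X | [disjoint neighbors x & cls f b]].

(** As [x] sees no vertex of colour [b], it can enter that class at once, and the cascade may end at
    any colour reachable from [b]. *)
Lemma zero_dominating x y a b : f x = Some a -> a \in acc f ->
  b \in zeros x (blk f) -> y \in solo x -> y \in colored_in f (reach f b) ->
  y \in dominating x.
Proof.
move=> fx aA; rewrite 2!inE => /andP[/andP[bL bB] dis] yS /colored_inP[c fy cR].
apply: exchange_dominating fx aA yS bL bB _ _.
  move=> w xw fw; have := disjointFr dis (x := w).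
  by rewrite in_nbr in_cls fw eqxx => /(_ xw).
by move=> d; rewrite fy => -[<-]; rewrite inE in cR.
Qed.

Lemma card_setI_solo x Z :
  #|solo x :&: Z| + #|(neighbors x :\: solo x) :&: Z| = #|neighbors x :&: Z|.
Proof.
rewrite -(cardsID (solo x) (neighbors x :&: Z)); congr (_ + _).
  by apply: eq_card => y; rewrite in_setI [in RHS]in_setI in_setI; case: (boolP (y \in solo x));
    rewrite ?andbF //= => /(subsetP (solo_sub x)) ->; rewrite andbT.
by apply: eq_card => y; rewrite in_setI !in_setD in_setI; case: (y \in solo x).
Qed.

(* A class of a colour of [X] in the list of [x] contains no neighbour of [x],
   at least two, a non-solo neighbour, or a single solo neighbour; in the last
   case an exchange inside the class shows that this neighbour dominates. *)
Lemma local_bound x a X : f x = Some a -> a \in acc f -> X \subset blk f ->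
  5 <= #|solo x| -> #|neighbors x :&: colored_in f X| <= #|L x :&: X| + 1 ->
  #|solo x :&: colored_in f X| + #|neighbors x :&: colored_in f X|
    <= #|L x :&: X| + 4 + 2 * #|zeros x X|.
Proof.
move=> fx aA /subsetP sX S5 d1; have D1 := dominating_le1 S5.
have zsub : zeros x X \subset L x :&: X by apply/subsetP=> b; rewrite inE => /andP[].
(* Let d be the number of neighbours of [x] coloured from [X]. Non-solo ones number d minus the solo
   ones, so [h] bounds solo + d by 3 d + 1 - 2 |L x :&: X| + 2 |zeros x X|, and [d1] bounds d. *)
suff h : 2 * #|(L x :&: X) :\: zeros x X| <= #|neighbors x :&: colored_in f X|
    + #|(neighbors x :\: solo x) :&: colored_in f X| + #|dominating x|.
  move: (card_setI_solo x (colored_in f X)) h d1 D1.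
  rewrite cardsD (setIidPr zsub); clear; lia.
apply: leq_trans (_ : _ <= #|neighbors x :&: colored_in f X|
    + #|(neighbors x :\: solo x) :&: colored_in f X|
    + #|dominating x :&: colored_in f X|) _; last first.
  by rewrite leq_add2l subset_leq_card // subsetIl.
rewrite !card_setI_colored_in -!big_split /= mulnC -sum_nat_const.
pose B := (L x :&: X) :\: zeros x X; rewrite -/B [leqRHS](big_setID B) /=.
have /setIidPr-> : B \subset X.
  by apply: subset_trans (subsetDl _ _) (subsetIr _ _).
apply: leq_trans (leq_addr _ _); apply: leq_sum => b.
rewrite inE => /andP[nz bLX]; move: nz; rewrite inE bLX /= -setI_eq0 => nz.
have [bL bX] := setIP bLX; have [d0|d2] := leqP #|neighbors x :&: cls f b| 1; last first.
  by rewrite -addnA; apply: leq_trans d2 (leq_addr _ _).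
have d10 : #|neighbors x :&: cls f b| == 1 by rewrite eqn_leq d0 card_gt0.
have /cards1P[y ey] := d10; rewrite (eqP d10) -addnA add1n ltnS.
have [xy /eqP fy] : y \in neighbors x /\ f y == Some b.
  by apply/andP; have := set11 y; rewrite -ey inE in_cls.
have [yS|yS] := boolP (y \in solo x).
  apply: ltn_addl; apply/card_gt0P; exists y; rewrite in_setI in_cls fy eqxx andbT.
  apply: exchange_dominating fx aA yS bL (sX _ bX) _ _.
    move=> w xw fw; apply/set1P; rewrite -ey in_setI in_nbr xw in_cls.
    by apply/eqP.
  by move=> c; rewrite fy => -[<-].
apply: ltn_addr; apply/card_gt0P; exists y.
by rewrite in_setI in_setD yS xy in_cls fy eqxx.
Qed.

(** Double counting: for each accessible colour [d] in its list, [y] receives weight 2, from a solo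
    edge counted twice, from two edges, or from one edge and membership in [ex d]. *)
Lemma weight_sum X : X \subset blk f ->
  2 * \sum_(y in colored_in f X) #|L y :&: acc f|
    <= \sum_(x in colored_in f (acc f))
         (#|solo x :&: colored_in f X| + #|neighbors x :&: colored_in f X|)
       + \sum_c #|ex c|.
Proof.
move=> sX; pose w x y := (y \in solo x) + (y \in neighbors x).
have -> : \sum_(x in colored_in f (acc f))
      (#|solo x :&: colored_in f X| + #|neighbors x :&: colored_in f X|)
    = \sum_(y in colored_in f X) \sum_(c in acc f) \sum_(x in cls f c) w x y.
  rewrite [RHS](eq_bigr (fun y => \sum_(x in colored_in f (acc f)) w x y)).
    rewrite [RHS]exchange_big; apply: eq_bigr => x _.
    by rewrite big_split /= !card_setI_sum.
  by move=> y _; rewrite sum_colored_in.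
apply: leq_trans (_ : _ <= \sum_(y in colored_in f X)
    (\sum_(c in acc f) \sum_(x in cls f c) w x y + \sum_c (y \in ex c))) _.
  rewrite big_distrr /=; apply: leq_sum => y yX.
  have [c fy cX] := colored_inP _ _ _ yX.
  have cB := subsetP sX _ cX.
  rewrite mulnC -sum_nat_const.
  rewrite [X in _ <= X + _](big_setID (L y)) /= [acc f :&: L y]setIC -addnA.
  apply: leq_trans (_ : _ <= \sum_(d in L y :&: acc f)
     (\sum_(x in cls f d) w x y + (y \in ex d))) _; last first.
    rewrite big_split /= leq_add2l.
    apply: leq_trans (leq_addl _ _).
    by rewrite [leqRHS](bigID (mem (L y :&: acc f))) leq_addr.
  apply: leq_sum => d; rewrite in_setI => /andP[dL dA].
  have [x xy fx] : exists2 x, adj y x & f x = Some d.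
    apply: not_disjoint_cls.
    apply: (closed_nbr (@closed_blk f) fy cB dL).
    by rewrite in_setC negbK.
  have xd : x \in cls f d by rewrite in_cls fx.
  rewrite (big_setD1 x xd) /= {1}/w in_nbr adj_sym xy.
  have [|yS] := boolP (y \in solo x); first by clear; lia.
  have [|yE] := boolP (y \in ex d); first by clear; lia.
  have [x' xd' yx'] : exists2 x', x' \in cls f d :\ x & adj x' y.
    apply/exists_inP; apply: contraR yS => /exists_inPn no.
    apply/(soloP y fx); split=> //; first by rewrite adj_sym.
      by rewrite (in_colored _ fy).
    move=> z yz fz; apply/eqP/negPn/negP=> zx; have := no z.
    by rewrite !inE fz eqxx zx adj_sym yz => /(_ isT).
  by rewrite (big_setD1 x' xd') /= {1}/w in_nbr yx'; clear; lia.
rewrite big_split /= leq_add2l exchange_big; apply: leq_sum => c _ /=.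
rewrite -card_setI_sum.
by rewrite subset_leq_card // subsetIl.
Qed.

(** Of at most [r] neighbours of [x], one is used up by each accessible colour of its list other
    than [a]. *)
Lemma degree_bound x a : f x = Some a -> a \in acc f ->
  (forall c, c \in L x -> c \in acc f -> c != a ->
     ~~ [disjoint neighbors x & cls f c]) ->
  #|neighbors x :&: colored_in f (blk f)| <= #|L x :&: blk f| + 1.
Proof.
move=> fx aA blocked.
have h : #|(L x :&: acc f) :\ a| <= #|neighbors x :&: colored_in f (acc f)|.
  apply: leq_trans (_ : #|neighbors x :&: colored_in f ((L x :&: acc f) :\ a)| <= _).
    apply: card_le_colored_in => c; rewrite in_setD1 in_setI => /and3P[ca cL cA].
    exact: blocked.
  apply/subset_leq_card/setIS/colored_inS.
  by apply: subset_trans (subsetDl _ _) (subsetIr _ _).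
have aL : a \in L x by case: st => -[_ l] _ _; apply: l fx.
have := cardsD1 a (L x :&: acc f); rewrite in_setI aL aA /=.
have := cardsID (acc f) (L x); rewrite hL setDE.
have := hdeg x; have dis : [disjoint acc f & blk f].
  by rewrite disjoints_subset setCK.
have := card_setI_disjointU (neighbors x) (colored_in_disjoint f dis).
have := subset_leq_card (subsetIl (neighbors x)
  (colored_in f (acc f) :|: colored_in f (blk f))).
move: h; clear; lia.
Qed.

(** A zero outside [small f] would yield two dominating solo neighbours. *)
Lemma zeros_small x a : f x = Some a -> a \in acc f -> 5 <= #|solo x| ->
  (forall b, b \in zeros x (blk f) -> b \notin small f ->
     1 < #|solo x :&: colored_in f (reach f b)|) ->
  zeros x (blk f) \subset small f.
Proof.
move=> fx aA S5 h; apply/subsetP=> b bZ; apply/negPn/negP=> /(h b bZ).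
rewrite ltnNge => /negP; apply; apply: leq_trans (dominating_le1 S5).
apply/subset_leq_card/subsetP=> y; rewrite inE => /andP[yS yR].
exact: zero_dominating fx aA bZ yS yR.
Qed.

End Exchange.

Lemma setD_blk f u : L u :\: blk f = L u :&: acc f.
Proof. by rewrite setDE setCK. Qed.

Lemma card_acc_ge f u : r - #|blk f| <= #|L u :&: acc f|.
Proof.
rewrite -setD_blk cardsD hL leq_sub2l //.
by rewrite subset_leq_card // subsetIr.
Qed.

Lemma card_colored_acc f : state f ->
  #|colored_in f (acc f)| + #|blk f| * s < r * s.
Proof.
move=> st; have dis : [disjoint blk f & acc f].
  by rewrite disjoint_sym disjoints_subset setCK.
by have := card_colored_lt st dis; rewrite (card_colored_blk st) // addnC.
Qed.

Lemma few_solo f ex x X : #|solo f ex x| <= 4 ->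
  #|solo f ex x :&: colored_in f X| + #|neighbors x :&: colored_in f X| <= r + 4.
Proof.
move=> S4; rewrite addnC leq_add //.
  by apply: leq_trans (hdeg x); rewrite subset_leq_card // subsetIl.
by apply: leq_trans S4; rewrite subset_leq_card // subsetIl.
Qed.

(** * The case of r - 2 blocked colours *)

Section TwoFree.
Variable f : G -> option K.
Hypothesis st : state f.
Hypothesis blk2 : #|blk f| = r - 2.

Lemma blk_min2 g : state g -> #|blk f| <= #|blk g|.
Proof. by move=> sg; rewrite blk2; have /andP[] := blk_card sg. Qed.

(* Once [y] has found a place among the accessible colours, the uncoloured
   vertex [v] can be brought into the class that [y] has left. *)
Lemma no_exit g y : y \in colored_in f (blk f) -> state g ->
  (forall u d, d \in blk f -> (g u == Some d) = (f u == Some d) && (u != y)) ->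
  False.
Proof.
move=> yB sg same; have [c fy cB] := colored_inP _ _ _ yB.
have [pg szg domg] := sg.
have : c \in reach_start f by rewrite reach_startE.
rewrite inE => /exists_inP[b]; rewrite inE => fr; rewrite inE => bc.
have bB := free_blk st fr.
have [] := @cascade _ _ L f g (blk f) v b c (@closed_blk f) bB bc.
- move=> u d fu dB /eqP dc; apply/eqP; rewrite same // fu eqxx /=.
  exact: colored_neq fu fy dc.
- by move=> u d /eqP + dB; rewrite same // => /andP[/eqP].
- exact: pg.
- by apply/eqP; rewrite domg eqxx orbT.
- move/freeP: fr => [bL h]; apply/freeP; split=> // w vw /eqP.
  by rewrite same // => /andP[/eqP fw _]; apply: (h w).
move=> h [ph domh szh _]; apply: (no_coloring ph) => [d|u]; last first.
  by rewrite domh domg; case: (u =P v) => [->|_] /=; rewrite ?hv ?orbF.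
rewrite szh; case: (d =P c) => [->|_]; last by rewrite addn0.
have : cls g c = cls f c :\ y.
  by apply/setP=> u; rewrite in_setD1 !in_cls same // andbC.
move=> ->; have := cardsD1 y (cls f c); rewrite (blk_full st cB) in_cls fy eqxx.
by move=> e; rewrite e addnC.
Qed.

(** The accessible classes have fewer than 2 s vertices together, so at most one of them is full. *)
Lemma full_unique c d : c \in acc f -> d \in acc f -> c != d ->
  #|cls f c| < s \/ #|cls f d| < s.
Proof.
move=> cA dA cd; have [|cS] := ltnP #|cls f c| s; first by left.
have [|dS] := ltnP #|cls f d| s; first by right.
have := card_colored_acc st; rewrite card_colored_in blk2.
rewrite (big_setD1 c cA) (big_setD1 d) /=; last by rewrite in_setD1 eq_sym cd.
have : 2 * s <= r * s by rewrite leq_mul2r (leq_trans _ hr) ?orbT.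
by rewrite mulnBl; move: cS dS; clear; lia.
Qed.

Lemma full_mover c : c \in acc f -> s <= #|cls f c| ->
  exists w d, [/\ f w = Some c, free L f w d, (d \in acc f) && (d != c)
    & #|cls f d| < s].
Proof.
move=> cA full; have /accP[e /connectP[p0 pth0 ee] eS] := cA.
move: ee; case/shortenP: pth0 => -[|d p] /= pth up _ ee.
  by move: full; rewrite leqNgt -ee eS.
have /andP[/existsP[w /andP[/eqP fw fr]] pth'] := pth.
have dA : d \in acc f.
  by apply/accP; exists e => //; apply/connectP; exists p.
have cd : c != d by move: up; rewrite inE negb_or => /andP[/andP[]].
exists w, d; rewrite dA eq_sym cd; split=> //; have [|//] := full_unique cA dA cd.
by rewrite ltnNge full.
Qed.

(** A neighbour of [w] that took the colour [d] would stop [w] from moving there; membership in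
    [ex d] excludes it from being solo for [d]. Since at most one accessible class is full, one such
    [w] suffices, which gives the bound [r] in [movers_exist]. *)
Definition movers (ex : K -> {set G}) := forall c, c \in acc f ->
  #|cls f c| < s \/ exists w d, [/\ f w = Some c, free L f w d,
    (d \in acc f) && (d != c), #|cls f d| < s & neighbors w \subset ex d].

Lemma movers_exist : exists2 ex, movers ex & \sum_c #|ex c| <= r.
Proof.
have [/exists_inP[c cA full]|/exists_inPn nofull] :=
  boolP [exists c in acc f, s <= #|cls f c|].
  have [w [d [fw fr dA dS]]] := full_mover cA full.
  exists (fun e => if e == d then neighbors w else set0).
    move=> e eA; have [->|ec] := eqVneq e c; last first.
      left; have := full_unique cA eA; rewrite eq_sym => /(_ ec)[|//].
      by rewrite ltnNge full.
    by right; exists w, d; split=> //; rewrite eqxx.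
  rewrite (bigD1 d) //= eqxx big1 ?addn0 ?hdeg // => e /negPf->.
  by rewrite cards0.
exists (fun=> set0); last by rewrite big1 // => c _; rewrite cards0.
by move=> c cA; left; rewrite ltnNge nofull.
Qed.

Variable ex : K -> {set G}.
Hypothesis hex : movers ex.

Lemma solo_blocked2 x y a c : f x = Some a -> a \in acc f ->
  y \in solo f ex x -> c \in L x -> c \in acc f -> c != a ->
  ~~ [disjoint neighbors x & cls f c].
Proof.
move=> fx aA /(soloP _ y fx)[xy yB aLy only yE] cL cA ca; apply/negP=> dis.
have [pf sz dom] := st; have [b fy bB] := colored_inP _ _ _ yB.
have xfree : free L f x c by rewrite /free cL.
have nxy : x != y := colored_neq fx fy (acc_blk_neq aA bB).
suff [g0 [pg0 g0x g0B g0sz g0y]] : exists g0, [/\ pcol L g0, g0 x = Some c,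
    forall u d, d \in blk f -> (g0 u == Some d) = (f u == Some d),
    (forall d, #|cls g0 d| + (a == d) <= s) /\
      (forall u, (g0 u == None) = (f u == None)) &
    forall w, adj y w -> g0 w <> Some a].
  have g0yb : g0 y = Some b by apply/eqP; rewrite g0B // fy.
  case: g0sz => g0sz g0dom.
  apply: (@no_exit (upd g0 y (Some a)) y yB).
    split; first by apply: pcol_upd => //; apply/freeP.
      move=> d; apply: leq_trans (g0sz d).
      by have := card_cls_upd g0 y (Some a) d; rewrite -[Some a == _]/(a == d) => <-;
        apply: leq_addr.
    move=> u; rewrite updE -dom -g0dom; case: (u =P y) => // ->.
    by rewrite g0yb.
  move=> u d dB; rewrite updE -g0B //; case: (u =P y) => [->|_]; last by rewrite andbT.
  rewrite andbF; apply/eqP=> -[e].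
  by have := acc_blk_neq aA dB; rewrite e eqxx.
have [cS|[w [d [fw fr /andP[dA dc] dS wE]]]] := hex cA.
  exists (upd f x (Some c)); split; first exact: pcol_upd.
  - exact: upd_same.
  - move=> u d dB; rewrite updE; case: (u =P x) => // ->; rewrite fx.
    apply/eqP/eqP=> -[e].
      by have := acc_blk_neq cA dB; rewrite e eqxx.
    by have := acc_blk_neq aA dB; rewrite e eqxx.
  - split=> [d|u]; last by rewrite updE; case: (u =P x) => // ->; rewrite fx.
    have := card_cls_upd f x (Some c) d; rewrite fx.
    rewrite -[Some a == _]/(a == d) -[Some c == _]/(c == d) => ->.
    by case: (c =P d) cS => [-> /=|_ _]; rewrite ?addn1 // addn0 sz.
  move=> w yw; rewrite updE; case: (w =P x) => [_ [e]|wx fw].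
    by rewrite e eqxx in ca.
  by apply: wx; apply: only.
(* To make room for [x], the vertex [w] first moves from [c] to [d]. If d = a, then [y] can still
   take [a], as it is outside [ex a] and hence not adjacent to [w]. *)
have nxw : x != w by apply: colored_neq fx fw _; rewrite eq_sym.
have g1x : upd f w (Some d) x = Some a by rewrite upd_neq.
exists (upd (upd f w (Some d)) x (Some c)); split.
- apply: pcol_upd; first exact: pcol_upd.
  move/freeP: xfree => [_ h]; apply/freeP; split=> // z xz; rewrite updE.
  by case: (z =P w) => [_ [e]|_]; [rewrite e eqxx in dc | apply: h].
- exact: upd_same.
- move=> u e eB; have nA b' : b' \in acc f -> (Some b' == Some e) = false.
    move=> bA; apply/eqP=> -[be]; have := acc_blk_neq bA eB.
    by rewrite be eqxx.
  rewrite !updE; case: (u =P x) => [->|_]; first by rewrite fx !nA.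
  by case: (u =P w) => [->|_] //; rewrite fw !nA.
- split=> [e|u]; last first.
    rewrite !updE; case: (u =P x) => [->|_]; first by rewrite fx.
    by case: (u =P w) => [->|_] //; rewrite fw.
  have := card_cls_upd (upd f w (Some d)) x (Some c) e; rewrite g1x.
  have := card_cls_upd f w (Some d) e; rewrite fw.
  rewrite -[Some c == _]/(c == e) -[Some d == _]/(d == e) -[Some a == _]/(a == e).
  have := sz e; case: (d =P e) dS => [->|_] /=; clear; lia.
move=> z yz; rewrite !updE; case: (z =P x) => [_ [e]|zx].
  by rewrite e eqxx in ca.
case: (z =P w) => [zw [e]|_ fz]; last by apply: zx; apply: only.
by case/negP: yE; rewrite -e; apply: (subsetP wE); rewrite in_nbr adj_sym -zw.
Qed.

(** Class sizes are unchanged, so only a full class matters. Its mover [w] is not [x], by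
    [solo_blocked2], and [y] does not block its target. *)
Lemma acc_stable2 g x y a : state g -> f x = Some a ->
  a \in acc f -> y \in solo f ex x -> (forall c, #|cls g c| = #|cls f c|) ->
  (forall w c, c \in acc f ->
     (g w == Some c) = (upd (upd f x None) y (Some a) w == Some c)) ->
  acc f \subset acc g.
Proof.
move=> sg fx aA yS szg gE; apply/subsetP=> c cA.
have [_ yB _ _ yE] := soloP _ y fx yS; have [b fy bB] := colored_inP _ _ _ yB.
have [cS|[w [d [fw fr /andP[dA dc] dS wE]]]] := hex cA.
  by apply: acc_nonfull; rewrite szg.
have /freeP[dL frw] := fr.
have wx : w != x.
  apply/eqP=> e; move: fx; rewrite -e fw => -[ec].
  have := solo_blocked2 (x := w) (a := c) fw cA _ dL dA dc.
  rewrite e => /(_ y yS); rewrite -e => /negP; apply.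
  by case/andP: fr.
have wy : w != y by apply: colored_neq fw fy (acc_blk_neq cA bB).
apply: (@acc_movable g c d); last by apply: acc_nonfull; rewrite szg.
apply/existsP; exists w; rewrite gE // !upd_neq // fw eqxx /=.
apply/freeP; split=> // z wz /eqP; rewrite gE // !updE.
case: (z =P y) => [zy /eqP[ad]|_].
  by case/negP: yE; rewrite ad; apply: (subsetP wE); rewrite -zy in_nbr.
by case: (z =P x) => // _ /eqP; apply: frw.
Qed.

Lemma two_free_absurd : \sum_c #|ex c| <= r -> False.
Proof.
move=> exr; have rs : 9 * s <= r * s by rewrite leq_mul2r hr orbT.
have szero := zeros_small st blk_min2 acc_stable2.
have W := card_colored_acc st; rewrite blk2 mulnBl in W.
have Q2 := small_card st; have s0 := s_gt0.
(* With at least 5 solo neighbours, all zeros are small and [local_bound] gives (r - 2) + 4 + 2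
   |small f|. *)
have omega x : x \in colored_in f (acc f) ->
   #|solo f ex x :&: colored_in f (blk f)| +
   #|neighbors x :&: colored_in f (blk f)| <= r + 4 + 2 * (#|small f| == 2).
  move=> /colored_inP[a fx aA]; have [S4|S5] := leqP #|solo f ex x| 4.
    by apply: leq_trans (leq_addr _ _); apply: few_solo.
  have zS : zeros f x (blk f) \subset small f.
    apply: (szero x a fx aA S5) => b bZ bS.
    have bB : b \in blk f by move: bZ; rewrite inE => /andP[/setIP[]].
    have -> : reach f b = blk f.
      apply/eqP; rewrite eqEcard (reach_sub (@closed_blk f)) // blk2.
      exact: small_reach.
    by rewrite (setIidPl (solo_sub_blk _ _ _)); apply: leq_trans S5.
  have /card_gt0P[y yS] : 0 < #|solo f ex x| by apply: leq_trans S5.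
  have d1 := degree_bound st fx aA
    (fun c cL cA ca => solo_blocked2 fx aA yS cL cA ca).
  apply: leq_trans (local_bound st blk_min2 acc_stable2 fx aA (subxx _) S5 d1) _.
  have := subset_leq_card zS; have := subset_leq_card (subsetIr (L x) (blk f)).
  rewrite blk2; move: Q2 hr; clear; case: eqP; lia.
have le2 := weight_sum ex (subxx (blk f)).
have le1 : \sum_(x in colored_in f (acc f)) (#|solo f ex x :&: colored_in f (blk f)|
      + #|neighbors x :&: colored_in f (blk f)|)
    <= #|colored_in f (acc f)| * (r + 4 + 2 * (#|small f| == 2)).
  by rewrite -sum_nat_const; apply: leq_sum.
have acc2 u : 2 <= #|L u :&: acc f|.
  by apply: leq_trans (card_acc_ge f u); rewrite blk2; move: hr; clear; lia.
have geP (P : {set K}) : P \subset blk f -> #|P| * s * 2 <=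
    \sum_(y in colored_in f P) #|L y :&: acc f|.
  move=> sP; rewrite -(card_colored_blk st sP) -sum_nat_const.
  exact: leq_sum.
(* With at most one small colour, 4 (r - 2) s <= (2 s - 1) (r + 4) + r, that is, 2 r s <= 16 s - 4,
   which fails for r >= 9. *)
have [e2|ne2] := eqVneq #|small f| 2; last first.
  have := geP _ (subxx _); rewrite blk2 => le3.
  move: le1 le2 le3 W exr hr rs; rewrite (negPf ne2) mulnBl; clear; nia.
(* With two small colours the weights rise to r + 6, but [two_closed] raises the other side as well;
   the outcome 6 r s <= 52 s - 18 again fails. *)
have := two_closed st (@closed_blk f) (subxx _) blk2 (@closed_small f)
  (small_sub f) e2.
under eq_bigr => y _ do rewrite setD_blk.
have := geP (blk f :\: small f) (subsetDl _ _).
rewrite cardsD (setIidPr (small_sub f)) blk2 e2 => le3 le4.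
move: le2; rewrite [X in 2 * X]sum_colored_in (big_setID (small f)) /=.
rewrite (setIidPr (small_sub f)) -!sum_colored_in => le2.
move: le1 le2 le3 le4 W exr hr rs; rewrite e2 eqxx -subnDA mulnBl; clear; nia.
Qed.

End TwoFree.

(** * The case of r - 1 blocked colours in every state *)

Section OneFree.
Variable f : G -> option K.
Hypothesis st : state f.
Hypothesis blk1 : forall g, state g -> #|blk g| = r - 1.
Local Notation solo1 := (solo f (fun=> set0)).

Lemma blk_min1 g : state g -> #|blk f| <= #|blk g|.
Proof. by move=> sg; rewrite !blk1. Qed.

Lemma card_colored_acc1 g : state g -> #|colored_in g (acc g)| < s.
Proof.
move=> sg; have := card_colored_acc sg; rewrite blk1 // mulnBl mul1n.
have : 1 * s <= r * s by rewrite leq_mul2r (leq_trans _ hr) ?orbT.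
by clear; lia.
Qed.

(** The accessible classes together have fewer than [s] vertices, so accessibility depends on class
    sizes alone. *)
Lemma acc1P g c : state g -> (c \in acc g) = (#|cls g c| < s).
Proof.
move=> sg; apply/idP/idP => [cA|]; last exact: acc_nonfull.
apply: leq_ltn_trans (card_colored_acc1 sg).
by rewrite card_colored_in (big_setD1 c cA) leq_addr.
Qed.

Lemma acc_sub1 g : state g -> (forall c, #|cls g c| = #|cls f c|) ->
  acc f \subset acc g.
Proof. by move=> sg e; apply/subsetP=> c; rewrite !acc1P // e. Qed.

Lemma acc_stable1 g x y a : state g -> f x = Some a ->
  a \in acc f -> y \in solo1 x -> (forall c, #|cls g c| = #|cls f c|) ->
  (forall w c, c \in acc f ->
     (g w == Some c) = (upd (upd f x None) y (Some a) w == Some c)) ->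
  acc f \subset acc g.
Proof. by move=> sg _ _ _ e _; apply: acc_sub1. Qed.

(** Moving [x] to [c] leaves both classes non-full, as [x] is itself one of the fewer than [s]
    accessible vertices. Then [y] can move to [a], so its colour becomes accessible. *)
Lemma solo_blocked1 x y a c : f x = Some a -> a \in acc f ->
  y \in solo1 x -> c \in L x -> c \in acc f -> c != a ->
  ~~ [disjoint neighbors x & cls f c].
Proof.
move=> fx aA /(soloP _ y fx)[xy yB aLy only _] cL cA ca; apply/negP=> dis.
have [pf sz dom] := st; have [b fy bB] := colored_inP _ _ _ yB.
have nyx : y != x.
  by rewrite eq_sym; apply: colored_neq fx fy (acc_blk_neq aA bB).
pose g := upd f x (Some c).
have szg d : #|cls g d| + (a == d) = #|cls f d| + (c == d).
  by have := card_cls_upd f x (Some c) d; rewrite fx.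
have cS : #|cls f c| < s.-1.
  have := card_colored_acc1 st; rewrite card_colored_in (big_setD1 c cA).
  rewrite (big_setD1 a) /=; last by rewrite in_setD1 eq_sym ca.
  have : 0 < #|cls f a| by apply/card_gt0P; exists x; rewrite in_cls fx.
  by clear; lia.
have sg : state g.
  split=> [|d|u]; first by apply: pcol_upd; rewrite // /free cL.
    have := szg d; have := sz d; case: (c =P d) cS => [->|_]; clear; lia.
  by rewrite /g updE -dom; case: (u =P x) => // ->; rewrite fx.
have sub : acc f \subset acc g.
  apply/subsetP=> d; rewrite !acc1P //; have := szg d.
  by case: (c =P d) cS => [->|_]; clear; lia.
apply: (blk_minimal blk_min1 sg sub bB); apply: acc_movable (subsetP sub _ aA).
apply/existsP; exists y; rewrite /g upd_neq // fy eqxx /=.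
apply/freeP; split=> // w yw; rewrite updE; case: (w =P x) => [_ [e]|wx fw].
  by rewrite e eqxx in ca.
by apply: wx; apply: only.
Qed.

(* As in [exchange], [x0] enters [reach f b0] and pushes the vertex [y2] out of
   it; but [y2] replaces [x2], which in turn replaces [y], which replaces [x0]. *)
Lemma double_exchange x0 x2 y y' y2 a0 a2 b0 b1 :
  f x0 = Some a0 -> a0 \in acc f -> f x2 = Some a2 -> a2 \in acc f ->
  y \in solo1 x0 -> y' \in solo1 x0 -> y' != y ->
  f y = Some b1 -> f y' = Some b1 -> b1 \in blk f -> b1 \notin reach f b0 ->
  b0 \in zeros f x0 (blk f) -> free L f x2 b1 ->
  y2 \in solo1 x2 -> y2 \in colored_in f (reach f b0) ->
  ~~ adj y y2 -> ~~ adj y' y2 -> False.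
Proof.
move=> fx0 a0A fx2 a2A yS yS' nyy fy fy' b1B b1R b0Z fr2 y2S y2R nad nad'.
have [pf sz dom] := st.
have [x0y _ a0Ly yonly _] := soloP _ y fx0 yS.
have [x0y' _ a0Ly' yonly' _] := soloP _ y' fx0 yS'.
have [x2y2 _ a2Ly2 y2only _] := soloP _ y2 fx2 y2S.
have [c fy2 cR] := colored_inP _ _ _ y2R.
have [b0L b0B] : b0 \in L x0 /\ b0 \in blk f.
  by move: b0Z; rewrite inE => /andP[/setIP[]].
have zero w : adj x0 w -> f w <> Some b0.
  move: b0Z; rewrite inE => /andP[_ dis] xw fw.
  by have := disjointFr dis (x := w); rewrite in_nbr in_cls fw eqxx => /(_ xw).
have RB d : d \in reach f b0 -> d \in blk f.
  exact/subsetP/(reach_sub (@closed_blk f) b0B).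
have nA u w d e : f u = Some d -> d \in acc f -> f w = Some e -> e \in blk f ->
    (u == w) = false.
  by move=> fu dA fw eB; apply/negbTE; apply: colored_neq fu fw (acc_blk_neq dA eB).
have cB := RB _ cR.
have x02 : (x0 == x2) = false.
  apply/eqP=> e; move: fr2 => /freeP[_ /(_ y)]; rewrite -e => /(_ x0y).
  by rewrite fy.
have yy2 : (y == y2) = false.
  by apply/eqP=> e; move: b1R; rewrite -(_ : c = b1) ?cR //; move: fy; rewrite e fy2 => -[].
have yy2' : (y' == y2) = false.
  by apply/eqP=> e; move: b1R; rewrite -(_ : c = b1) ?cR //; move: fy'; rewrite e fy2 => -[].
have [E1 E2 E3] : [/\ (x0 == y) = false, (x0 == y2) = false & (x0 == y') = false].
  by split; [apply: nA fx0 _ fy _|apply: nA fx0 _ fy2 _|apply: nA fx0 _ fy' _].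
have [E4 E5 E6] : [/\ (x2 == y) = false, (x2 == y2) = false & (x2 == y') = false].
  by split; [apply: nA fx2 _ fy _|apply: nA fx2 _ fy2 _|apply: nA fx2 _ fy' _].
(* The colours [a0] and [a2] may coincide; this is why [y2] must not be adjacent to [y] or [y']. *)
pose f1 := upd (upd f x0 None) x2 (Some b1).
pose f2 := upd f1 y (Some a0).
pose f3 := upd f2 y2 (Some a2).
have f3in u d : f3 u = Some d -> d \in reach f b0 -> f u = Some d.
  move=> + dR; have dB := RB _ dR; rewrite /f3 /f2 /f1 !updE.
  case: (u =P y2) => [_ [e]|_]; first by have := acc_blk_neq a2A dB; rewrite e eqxx.
  case: (u =P y) => [_ [e]|_]; first by have := acc_blk_neq a0A dB; rewrite e eqxx.
  case: (u =P x2) => [_ [e]|_]; first by rewrite e dR in b1R.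
  by case: (u =P x0).
have [] := @cascade _ _ L f f3 (reach f b0) x0 b0 c (@closed_reach f b0)
  (reach_refl f b0) _ _ f3in.
- by rewrite inE in cR.
- move=> u d fu dR /eqP dc; have dB := RB _ dR; rewrite /f3 /f2 /f1 !updE.
  rewrite (negPf (colored_neq fu fy2 dc)) (_ : (u == y) = false).
    by rewrite ![u == _]eq_sym (nA _ _ _ _ fx2 a2A fu dB) (nA _ _ _ _ fx0 a0A fu dB).
  by apply/eqP=> e; move: b1R; rewrite -(_ : d = b1) ?dR //; move: fu; rewrite e fy => -[].
- apply: pcol_upd.
    apply: pcol_upd.
      apply: pcol_upd; first exact: pcol_erase.
      move/freeP: fr2 => [bL h]; apply/freeP; split=> // w xw; rewrite updE.
      by case: (w =P x0) => // _; apply: h.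
    apply/freeP; split=> // w yw; rewrite /f1 !updE.
    case: (w =P x2) => [_ [e]|_]; first by have := acc_blk_neq a0A b1B; rewrite e eqxx.
    by case: (w =P x0) => // ne fw; apply: ne; apply: yonly.
  apply/freeP; split=> // w yw; rewrite /f2 /f1 !updE.
  case: (w =P y) => [e _|_]; first by case/negP: nad; rewrite adj_sym -e.
  case: (w =P x2) => [_ [e]|ne]; first by have := acc_blk_neq a2A b1B; rewrite e eqxx.
  by case: (w =P x0) => // _ fw; apply: ne; apply: y2only.
- by rewrite /f3 /f2 /f1 !updE E1 E2 x02 eqxx.
- by apply/freeP; split=> // w xw /f3in/(_ (reach_refl f b0)); apply: zero.
move=> g [pg domg szg outg].
have szE d : #|cls g d| = #|cls f d|.
  have := card_cls_upd f x0 None d; rewrite fx0.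
  have := card_cls_upd (upd f x0 None) x2 (Some b1) d.
  rewrite upd_neq ?fx2; last by rewrite eq_sym x02.
  have := card_cls_upd f1 y (Some a0) d.
  rewrite {2}/f1 !upd_neq ?fy; try by rewrite eq_sym ?E4 ?E1.
  have := card_cls_upd f2 y2 (Some a2) d.
  rewrite {2}/f2 {1}/f1 !upd_neq ?fy2; try by rewrite eq_sym ?E5 ?E2 ?yy2.
  rewrite szg -/f1 -/f2 -/f3 (eq_sym d) -[Some c == _]/(c == d) /=.
  by clear; lia.
have aR a : a \in acc f -> a \notin reach f b0.
  by move=> aA; apply/negP=> /RB aB; have := acc_blk_neq aA aB; rewrite eqxx.
have sg : state g.
  split=> // [d|u]; first by rewrite szE.
  rewrite domg -dom /f3 /f2 /f1 !updE.
  case: (u =P y2) => [->|_]; first by rewrite fy2 andbF.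
  case: (u =P y) => [->|_]; first by rewrite fy andbF.
  case: (u =P x2) => [->|_]; first by rewrite fx2 andbF.
  by case: (u =P x0) => [->|_] //; rewrite fx0.
have sub : acc f \subset acc g := acc_sub1 sg szE.
(* The vertex [y'] still has colour [b1] and no longer sees [a0], so [b1] has become accessible. *)
apply: (blk_minimal blk_min1 sg sub b1B); apply: acc_movable (subsetP sub _ a0A).
apply/existsP; exists y'; apply/andP; split.
  rewrite outg // /f3 /f2 /f1 !updE yy2' (negPf nyy) ![y' == _]eq_sym E6 E3.
  by rewrite fy'.
apply/freeP; split=> // w yw /eqP; rewrite (outg w a0 (aR _ a0A)) /f3 /f2 /f1 !updE.
case: (w =P y2) => [e _|_]; first by case/negP: nad'; rewrite -e.
case: (w =P y) => [e _|_].
  by case: pf => p _; apply: (p _ _ b1 yw); rewrite // e.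
case: (w =P x2) => [_ /eqP[e]|_]; first by have := acc_blk_neq a0A b1B; rewrite e eqxx.
by case: (w =P x0) => // ne /eqP fw; apply: ne; apply: yonly'.
Qed.

Lemma degree_bound1 x : x \in colored_in f (acc f) -> 5 <= #|solo1 x| ->
  #|neighbors x :&: colored_in f (blk f)| <= #|L x :&: blk f| + 1.
Proof.
move=> /colored_inP[a fx aA] S5.
have /card_gt0P[y yS] : 0 < #|solo1 x| by apply: leq_trans S5.
apply: (degree_bound st fx aA) => c cL cA ca.
exact: solo_blocked1 fx aA yS cL cA ca.
Qed.

Lemma solo_reach_le1 x b : x \in colored_in f (acc f) -> 5 <= #|solo1 x| ->
  b \in zeros f x (blk f) -> #|solo1 x :&: colored_in f (reach f b)| <= 1.
Proof.
move=> /colored_inP[a fx aA] S5 bZ.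
apply: leq_trans (dominating_le1 S5); apply/subset_leq_card/subsetP=> y.
rewrite inE => /andP[yS yR].
exact: (zero_dominating st blk_min1 acc_stable1 fx aA bZ yS yR).
Qed.

(** If [b] reached all of [blk f], each of the at least 5 solo neighbours would be dominating. *)
Lemma card_reach_zero x b : x \in colored_in f (acc f) -> 5 <= #|solo1 x| ->
  b \in zeros f x (blk f) -> b \notin small f -> #|reach f b| = r - 2.
Proof.
move=> xA S5 bZ bS; have bB : b \in blk f.
  by move: bZ; rewrite inE => /andP[/setIP[]].
have sub := reach_sub (@closed_blk f) bB.
have ge := small_reach st bB bS; have le := subset_leq_card sub.
rewrite blk1 // in le; have [e|] := eqVneq #|reach f b| (r - 1); last first.
  by move: ge le hr; clear; lia.
have E : reach f b = blk f by apply/eqP; rewrite eqEcard sub e (blk1 st) /=.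
have := solo_reach_le1 xA S5 bZ.
rewrite E (setIidPl (solo_sub_blk _ _ _)) => S1.
by move: (leq_trans S5 S1).
Qed.

Lemma weight_sum1 X m : X \subset blk f ->
  (forall x, x \in colored_in f (acc f) -> #|solo1 x :&: colored_in f X|
     + #|neighbors x :&: colored_in f X| <= m) ->
  2 * \sum_(y in colored_in f X) #|L y :&: acc f| <= #|colored_in f (acc f)| * m.
Proof.
move=> sX h; have := weight_sum (fun=> set0) sX.
rewrite [X in _ + X]big1 ?addn0 => [/leq_trans-> //|c _]; last by rewrite cards0.
by rewrite -sum_nat_const; apply: leq_sum.
Qed.

(** Otherwise [local_bound] gives weight at most (r - 1) + 4 + 2 * 2 = r + 7 everywhere, and fewer
    than [s] vertices cannot supply 2 (r - 1) s. *)
Lemma zeros_not_small : exists x b, [/\ x \in colored_in f (acc f),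
  5 <= #|solo1 x|, b \in zeros f x (blk f) & b \notin small f].
Proof.
have [/exists_inP[x xA /andP[S5 /subsetPn[b bZ bS]]]|/exists_inPn no] :=
  boolP [exists x in colored_in f (acc f),
           (5 <= #|solo1 x|) && ~~ (zeros f x (blk f) \subset small f)].
  by exists x, b.
have : 2 * \sum_(y in colored_in f (blk f)) #|L y :&: acc f|
    <= #|colored_in f (acc f)| * (r + 7).
  apply: weight_sum1 => // x xA; have [S4|S5] := leqP #|solo1 x| 4.
    by apply: leq_trans (few_solo (ex := fun=> set0) _ S4) _; rewrite leq_add2l.
  have := no x xA; rewrite S5 negbK /= => zS.
  have [a fx aA] := colored_inP _ _ _ xA.
  have := local_bound st blk_min1 acc_stable1 fx aA (subxx _) S5 (degree_bound1 xA S5).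
  have := subset_leq_card zS; have := subset_leq_card (subsetIr (L x) (blk f)).
  have := small_card st; rewrite blk1 //; move: hr; clear; lia.
have : #|colored_in f (blk f)| * 1 <= \sum_(y in colored_in f (blk f)) #|L y :&: acc f|.
  rewrite -sum_nat_const; apply: leq_sum => y _.
  by apply: leq_trans (card_acc_ge f y); rewrite blk1 //; move: hr; clear; lia.
rewrite (card_colored_blk st) // blk1 // muln1.
have := card_colored_acc1 st; have := s_gt0; move: hr; clear; nia.
Qed.

(** Given two such small colours, [two_closed] provides many edges to the accessible classes, minus
    2 s for the one blocked colour outside the reach. Fewer than [s] accessible vertices of degree
    at most [r] cannot meet them. *)
Lemma small_reach_le1 b : #|reach f b| = r - 2 -> b \in blk f ->
  #|small f :&: reach f b| <= 1.
Proof.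
move=> R2 bB; have sub := reach_sub (@closed_blk f) bB.
have := subset_leq_card (subsetIl (small f) (reach f b)).
move/leq_trans/(_ (small_card st)); rewrite leq_eqVlt => /orP[/eqP e2|//].
have cQ : closed f (small f :&: reach f b).
  by apply: closedI; [apply: closed_small|apply: closed_reach].
have two := two_closed st (@closed_reach f b) sub R2 cQ (subsetIr _ _) e2.
set Q := small f :&: reach f b in e2 cQ two.
have sQ : Q \subset blk f by apply: subset_trans sub; apply: subsetIr.
have LR y : #|L y :\: reach f b| <= #|L y :&: acc f| + 1.
  have : L y :\: reach f b \subset (L y :&: acc f) :|: (blk f :\: reach f b).
    apply/subsetP=> c /setDP[cL nr]; rewrite in_setU in_setI cL in_setD nr in_setC.
    by case: (c \in acc f).
  move/subset_leq_card/leq_trans; apply; rewrite cardsU.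
  apply: leq_trans (leq_subr _ _) _; rewrite leq_add2l cardsD (setIidPr sub).
  by rewrite R2 blk1 //; move: hr; clear; lia.
have leQ : \sum_(y in colored_in f Q) #|L y :\: reach f b|
    <= \sum_(y in colored_in f Q) #|L y :&: acc f| + 2 * s.
  rewrite -e2 -(card_colored_blk st sQ) -sum1_card -big_split.
  by apply: leq_sum => y _; apply: LR.
have leY : (r - 4) * s
    <= \sum_(y in colored_in f (reach f b :\: Q)) #|L y :&: acc f|.
  have cY : #|reach f b :\: Q| = r - 4.
    by rewrite cardsD (setIidPr (subsetIr _ _)) R2 e2; move: hr; clear; lia.
  have sY : reach f b :\: Q \subset blk f by apply: subset_trans sub; apply: subsetDl.
  rewrite -cY -(card_colored_blk st sY) -sum1_card; apply: leq_sum => y _.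
  by apply: leq_trans (card_acc_ge f y); rewrite blk1 //; move: hr; clear; lia.
have leA : \sum_(y in colored_in f (reach f b)) #|L y :&: acc f|
    <= #|colored_in f (acc f)| * r.
  apply: leq_trans (_ : _ <= \sum_(y in colored_in f (reach f b))
      #|neighbors y :&: colored_in f (acc f)|) _.
    apply: leq_sum => y yR; apply: (closed_card_nbr (@closed_blk f)).
      by rewrite disjoint_sym disjoints_subset setCK.
    exact: subsetP (colored_inS f sub) y yR.
  rewrite sum_nbr_swap -sum_nat_const; apply: leq_sum => x _.
  by apply: leq_trans (hdeg x); rewrite subset_leq_card // subsetIl.
have eQ : reach f b :&: Q = Q by apply/setIidPr/subsetIr.
move: leA; rewrite sum_colored_in (big_setID Q) /= eQ.
rewrite -!sum_colored_in => leA.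
have : #|colored_in f (acc f)| * r + r <= s * r.
  by rewrite addnC -mulSn leq_mul2r card_colored_acc1 ?orbT.
have : 9 * s <= r * s by rewrite leq_mul2r hr orbT.
by move: leA leY leQ two; rewrite mulnBl (mulnC s r); clear; lia.
Qed.

Lemma one_free_absurd : False.
Proof.
have [x0 [b0 [x0A S05 b0Z b0S]]] := zeros_not_small.
have b0B : b0 \in blk f by move: b0Z; rewrite inE => /andP[/setIP[]].
have R2 := card_reach_zero x0A S05 b0Z b0S.
have sub := reach_sub (@closed_blk f) b0B; set R0 := reach f b0 in R2 sub.
have /cards1P[b1 eb1] : #|blk f :\: R0| == 1.
  by rewrite cardsD (setIidPr sub) R2 blk1 //; move: hr; clear; lia.
have /setDP[b1B b1R] : b1 \in blk f :\: R0 by rewrite eb1 set11.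
have eB : blk f = R0 :|: [set b1].
  by rewrite -eb1 setDE setUIr setUCr setIT; apply/esym/setUidPr.
have disR : [disjoint R0 & [set b1]].
  by rewrite disjoint_sym disjoints1.
have colB : colored_in f (blk f) = colored_in f R0 :|: cls f b1.
  rewrite eB colored_inU; congr (_ :|: _); apply/setP=> u; rewrite !inE.
  by case: (f u) => //= d; rewrite inE.
have disC : [disjoint colored_in f R0 & cls f b1].
  rewrite -setI_eq0; apply/eqP/setP=> u; rewrite in_setI in_cls in_set0.
  apply/negP=> /andP[/colored_inP[d fu dR] /eqP]; rewrite fu => -[e].
  by rewrite -e dR in b1R.
have splitS x : #|solo1 x| = #|solo1 x :&: colored_in f R0| + #|solo1 x :&: cls f b1|.
  by rewrite -card_setI_disjointU // -colB (setIidPl (solo_sub_blk _ _ _)).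
have T0 : 4 <= #|solo1 x0 :&: cls f b1|.
  have := solo_reach_le1 x0A S05 b0Z; have := splitS x0; rewrite -/R0; move: S05; clear; lia.
have omega x : x \in colored_in f (acc f) ->
    #|solo1 x :&: colored_in f R0| + #|neighbors x :&: colored_in f R0| <= r + 4.
  move=> xA; have [S4|S5] := leqP #|solo1 x| 4; first exact: few_solo.
  have [a fx aA] := colored_inP _ _ _ xA.
  have [zS|/subsetPn[b bZ bS]] := boolP (zeros f x (blk f) \subset small f); last first.
    have bB : b \in blk f by move: bZ; rewrite inE => /andP[/setIP[]].
    have Rb2 := card_reach_zero xA S5 bZ bS.
    (* The intersection is closed and has at least r - 3 > 2 colours, hence at least r - 2 by
       [closed_size], and so equals both sets. *)
    have eR : R0 = reach f b.
      have subb := reach_sub (@closed_blk f) bB.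
      have cI : closed f (R0 :&: reach f b) by apply: closedI; apply: closed_reach.
      have subI : R0 :&: reach f b \subset blk f by apply: subset_trans sub; apply: subsetIl.
      have := subset_leq_card (_ : R0 :|: reach f b \subset blk f).
      rewrite subUset sub subb => /(_ isT); rewrite blk1 // cardsU R2 Rb2 => leU.
      have leI : r - 2 <= #|R0 :&: reach f b|.
        have /orP[] := closed_size st cI subI => //.
        by move: leU hr; clear; lia.
      have /eqP e1 : R0 :&: reach f b == R0 by rewrite eqEcard subsetIl R2.
      have /eqP e2 : R0 :&: reach f b == reach f b by rewrite eqEcard subsetIr Rb2.
      by rewrite -e2 e1.
    have S1 := solo_reach_le1 xA S5 bZ; rewrite -eR in S1.
    have : #|neighbors x :&: colored_in f R0| <= r.
      by apply: leq_trans (hdeg x); rewrite subset_leq_card // subsetIl.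
    by move: S1; clear; lia.
  have dB := degree_bound1 xA S5.
  have eL : #|L x :&: blk f| = #|L x :&: R0| + (b1 \in L x).
    rewrite eB (card_setI_disjointU _ disR); congr (_ + _).
    by rewrite card_setI_sum big_set1.
  have eN := card_setI_disjointU (neighbors x) disC; rewrite -colB in eN.
  (* Otherwise [x] is free to take [b1], and all its solo neighbours are coloured from [R0]. Either
     [double_exchange] applies, or each vertex of [T] misses at most one vertex of [U]. *)
  have nb1 : b1 \in L x -> 0 < #|neighbors x :&: cls f b1|.
    move=> b1L; rewrite card_gt0 setI_eq0; apply/negP=> dis.
    have fr : free L f x b1 by rewrite /free b1L.
    have T2 : 5 <= #|solo1 x :&: colored_in f R0|.
      move: S5; rewrite splitS; suff -> : solo1 x :&: cls f b1 = set0.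
        by rewrite cards0 addn0.
      apply/setP=> z; rewrite in_setI in_set0; apply/negP=> /andP[zx zb].
      have := disjointFr dis (subsetP (solo_sub _ _ _) _ zx).
      by rewrite zb.
    set T := solo1 x :&: colored_in f R0 in T2.
    set U := solo1 x0 :&: cls f b1 in T0.
    have [/exists_inP[y2 y2T two]|/exists_inPn no] :=
      boolP [exists y2 in T, 1 < #|U :\: neighbors y2|].
      have [y [y' [yU y'U ne]]] := card_gt1P two.
      have {yU} : y \in U :\: neighbors y2 by [].
      rewrite in_setD in_setI in_nbr in_cls => /and3P[n1 yS /eqP fy].
      have {y'U} : y' \in U :\: neighbors y2 by [].
      rewrite in_setD in_setI in_nbr in_cls => /and3P[n2 yS' /eqP fy'].
      have /setIP[y2S y2R] := y2T; have [a0 fx0 a0A] := colored_inP _ _ _ x0A.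
      apply: (double_exchange fx0 a0A fx aA yS yS' _ fy fy' b1B b1R b0Z fr y2S y2R).
      - by rewrite eq_sym.
      - by rewrite adj_sym.
      - by rewrite adj_sym.
    have disTU : [disjoint T & U].
      apply: disjointW disC; [exact: subsetIr|exact: subsetIr].
    (* For t = |T| and u = |U|, t (u - 1) <= 2 (t + u) - 4 means (t - 2) (u - 3) <= 2, impossible
       for t >= 5 and u >= 4. *)
    have := classB_cut hG disTU (leq_trans (leq_trans _ T2) (leq_addr _ _)).
    move=> /(_ isT); have : #|T| * (#|U| - 1) <= \sum_(z in T) #|neighbors z :&: U|.
      rewrite -sum_nat_const; apply: leq_sum => z /no; rewrite -leqNgt cardsD setIC.
      by clear; lia.
    by move: T0 T2; clear; nia.
  have d1 : #|neighbors x :&: colored_in f R0| <= #|L x :&: R0| + 1.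
    move: dB nb1; rewrite eL eN; case: (b1 \in L x) => [h /(_ isT)|h _]; move: h; clear; lia.
  have := local_bound st blk_min1 acc_stable1 fx aA sub S5 d1.
  have : zeros f x R0 \subset small f :&: R0.
    apply/subsetP=> b; rewrite 2!inE => /andP[/andP[bL bR] dis].
    rewrite in_setI bR andbT; apply: (subsetP zS).
    by rewrite inE in_setI bL (subsetP sub _ bR).
  move/subset_leq_card/leq_trans/(_ (small_reach_le1 R2 b0B)).
  have := subset_leq_card (subsetIr (L x) R0); rewrite R2; move: hr; clear; lia.
(* The weights in [R0] alone now give 2 (r - 2) s <= (s - 1) (r + 4), which fails. *)
have := weight_sum1 sub omega.
have : #|colored_in f R0| * 1 <= \sum_(y in colored_in f R0) #|L y :&: acc f|.
  rewrite -sum_nat_const; apply: leq_sum => y _.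
  by apply: leq_trans (card_acc_ge f y); rewrite blk1 //; move: hr; clear; lia.
rewrite (card_colored_blk st) // R2 muln1.
have := card_colored_acc1 st; have := s_gt0; move: hr; clear; nia.
Qed.

End OneFree.

(** * Induction on the vertices and passage to arbitrary colour types *)

Lemma state_absurd f : state f -> False.
Proof.
move=> st; apply: (one_free_absurd st) => g sg.
have /andP[ge le] := blk_card sg.
have [e|] := eqVneq #|blk g| (r - 2); last by move: ge le hr; clear; lia.
have [ex hex exr] := movers_exist sg e.
by case: (two_free_absurd sg e hex exr).
Qed.

End Stuck.

(** The class bound [s] stays fixed while vertices are removed from [D], so |D| <= r s is
    inherited. *)
Lemma finite_list_coloring (G : sgraph) (K : finType) (L : G -> {set K}) r s
    (D : {set G}) : in_classB G -> 9 <= r -> (forall x : G, #|neighbors x| <= r) ->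
  (forall x, #|L x| = r) -> #|D| <= r * s ->
  exists f, [/\ pcol L f, forall c, #|cls f c| <= s
    & forall u, (f u == None) = (u \notin D)].
Proof.
move=> hG hr hdeg hL; have [n] := ubnP #|D|.
elim: n D => // n IH D; rewrite ltnS => ltD leD.
have [->|D0] := eqVneq D set0.
  exists (fun=> None); split=> [|c|u]; last by rewrite in_set0.
    by split.
  by rewrite (_ : cls _ c = set0) ?cards0 //; apply/setP=> u; rewrite !inE.
have [v vD v6] := low_vertex hG D0; have cD := cardsD1 v D; rewrite vD in cD.
have [||f [pf sz dom]] := IH (D :\ v).
- by move: cD ltD; clear; lia.
- by move: cD leD; clear; lia.
apply: NNPP => no.
apply: (@state_absurd G K L r s D v hG hr hdeg hL vD v6 leD _ f).
  by move=> g pg szg domg; apply: no; exists g.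
by split=> // u; rewrite dom in_setD1 negb_and negbK orbC.
Qed.

Theorem theorem5 (G : sgraph) (r : nat) (hG : in_classB G)
    (hr : maxn 9 (max_degree G) <= r) :
  equitably_choosable G r.
Proof.
move=> C L hL; move: hr; rewrite geq_max => /andP[r9 rD].
have hdeg (x : G) : #|neighbors x| <= r.
  by apply: leq_trans rD; rewrite /max_degree (bigD1 x) //= leq_maxl.
(* The union of all lists serves as the finite type of colours; classes of other colours are
   empty. *)
pose F : {fset C} := (\bigcup_(x <- enum G) L x)%fset.
have LF x : (L x `<=` F)%fset.
  by apply/fsubsetP=> c cL; apply/bigfcupP; exists x; rewrite ?mem_enum.
pose L' x := fsub F (L x).
have hL' x : #|L' x| = r by rewrite card_fsub // hL.
have hs : #|[set: G]| <= r * ceil_div #|G| r.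
  rewrite cardsT /ceil_div mulnC; have := divn_eq (#|G| + r.-1) r.
  have := ltn_pmod (#|G| + r.-1) (leq_trans (ltn0Sn _) r9).
  by move: r9; clear; lia.
have [f [[prop lst] sz dom]] := finite_list_coloring hG r9 hdeg hL' hs.
have total x : exists c, f x = Some c.
  by have := dom x; rewrite in_setT; case: (f x) => // c _; exists c.
(* The empty graph is separate, as it provides no default colour [c0]; otherwise [f] is total and
   the default is never taken. *)
have [x0 _|no] := pickP (fun _ : G => true); last first.
  have abs (x : G) : False by have := no x.
  exists (fun x => match abs x with end); split=> [|c]; first by split=> x; case: (abs x).
  by rewrite eq_card0 // => x; case: (abs x).
have [c0 _] := total x0.
pose g x := val (odflt c0 (f x)); exists g.
have gE x c : f x = Some c -> g x = val c by rewrite /g => ->.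
split=> [|c].
  split=> [x y xy|x]; last first.
    by have [c fx] := total x; rewrite (gE _ _ fx); have := lst _ _ fx; rewrite in_fsub.
  have [c fx] := total x; have [d fy] := total y.
  rewrite (gE _ _ fx) (gE _ _ fy) (inj_eq val_inj).
  by apply/eqP=> e; apply: (prop x y c xy fx); rewrite e.
have [cF|cF] := boolP (c \in F).
  apply: leq_trans (sz [` cF]%fset); apply/subset_leq_card/subsetP=> x.
  rewrite !inE; have [d fx] := total x; rewrite (gE _ _ fx) fx => /eqP e.
  by apply/eqP; congr Some; apply: val_inj.
rewrite (_ : color_class g c = set0) ?cards0 //; apply/setP=> x; rewrite !inE.
by apply: contraNF cF => /eqP <-; apply: valP.
Qed.
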